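(* Consider the L-SVRG iteration (defined in the context) with stepsize $\eta>0$, probability $p\in(0,1]$ and sampling (or sampling with replacement) $S$. Suppose $f$ is convex, $L_f>0$ is such that $\frac{L_f}{2}\|x\|^2-f(x)$ is convex, and there are a minimizer $x^*$ of $P$ and a constant $\mathcal{L}_1>0$ such that for all $x\in\mathbb{R}^d$ $$\mathbb{E}\left[\left\|\tfrac1n(\mathbf{G}(x)-\mathbf{G}(x^* ))\theta_S\mathbf{I}_Se\right\|^2\right]\le 2\mathcal{L}_1\left(f(x)-f(x^* )-\langle\nabla f(x^* ),x-x^*\rangle\right).$$ Let $\alpha=\frac{6\eta}{5p}$ and $$\Psi^k=\frac{1}{2\eta}\|x^k-x^*\|^2+\alpha\mathcal{H}_S^k,\qquad \mathcal{H}_S^k=\left\|\tfrac1n(\mathbf{G}(w^k)-\mathbf{G}(x^* ))\theta_S\mathbf{I}_Se\right\|^2.$$ If $\eta\le\min\left\{\frac{1}{8\mathcal{L}_1},\frac{1}{6L_f}\right\}$, then for every $k\ge 0$ $$\mathbb{E}_k[P(x^{k+1})-P(x^* )]-\frac35\left(P(x^k)-P(x^* )\right)\le\mathbb{E}_k[\Psi^k]-\mathbb{E}_k[\Psi^{k+1}].$$ Let $\tilde x^k=(x^0+\dots+x^k)/(k+1)$. Assume $L_f\le\mathcal{L}_1$ and let $\eta=\frac{1}{8\mathcal{L}_1}$. Then $$\mathbb{E}[P(\tilde x^k)-P(x^* )]\le\frac{1}{k+1}\left(10\mathcal{L}_1\|x^0-x^*\|^2+\left(\frac52+\frac{3}{4p}\right)(P(x^0)-P(x^*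 ))\right).$$ This implies that, for $\epsilon>0$, $\mathbb{E}[P(\tilde x^k)-P(x^* )]\le\epsilon$ as long as $k\ge O\left(\left(\mathcal{L}_1+\frac1p\right)\frac1\epsilon\right)$, where the constant hidden in $O(\cdot)$ depends only on $\|x^0-x^*\|^2$ and $P(x^0)-P(x^* )$.
   Context: Problem: minimize $P(x)=f(x)+\psi(x)$ over $x\in\mathbb{R}^d$, where $f=\frac1n\sum_{i=1}^nf_i$, each $f_i:\mathbb{R}^d\to\mathbb{R}$ is differentiable, and $\psi:\mathbb{R}^d\to\mathbb{R}\cup\{+\infty\}$ is proper, closed and convex. $P$ has at least one global minimizer. The individual $f_i$ need not be convex. Sampling: $[n]=\{1,\dots,n\}$ and $e\in\mathbb{R}^n$ is the all-ones vector. $S$ is one of the following. (a) A proper sampling: a random subset of $[n]$ with $\mathbb{P}[i\in S]>0$ for all $i$, together with real weights $\theta_C^i$ ($i\in[n]$, $C\subseteq[n]$). (b) A sampling with replacement: $S$ consists of $\tau$ independent copies of an index drawn from a distribution on $[n]$ with probabilities $\tilde p_i>0$ (repetitions counted), with weights $\theta_S^i=1/(\tau\tilde p_i)$. $\theta_S$ is the $n\times n$ diagonal matrix with diagonal entries $\theta_S^i$, and $\mathbf{I}_S$ is the diagonal matrix whose $i$-th diagonal entry is the number of copies of $i$ in $S$. It is assumed that $\mathbb{E}[\theta_S\mathbf{I}_S]e=e$ (automatic in case (b)). $\mathbf{G}(x)=[\nabla f_1(x),\dots,\nabla f_n(x)]\in\mathbb{R}^{d\times n}$, so $\frac1n\mathbf{G}(x)\theta_S\mathbf{I}_Se=\frac1n\sum_{i\in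 S}\theta_S^i\nabla f_i(x)$ with multiplicities. Proximal operator: $\mathrm{prox}_\eta(x)=\arg\min_y\{\frac{1}{2\eta}\|x-y\|^2+\psi(y)\}$. L-SVRG: $x^0=w^0\in\mathbb{R}^d$. For $k=0,1,2,\dots$: draw $S_k$ as a fresh independent copy of $S$; set $g^k=\frac1n(\mathbf{G}(x^k)-\mathbf{G}(w^k))\theta_{S_k}\mathbf{I}_{S_k}e+\frac1n\mathbf{G}(w^k)e$; set $x^{k+1}=\mathrm{prox}_\eta(x^k-\eta g^k)$; set $w^{k+1}=x^k$ with probability $p$ and $w^{k+1}=w^k$ with probability $1-p$ (by an independent coin flip). $\mathbb{E}_k[\cdot]$ is the expectation conditional on $x^k$ and $w^k$. In $\mathcal{H}_S^k$ the symbol $S$ denotes a copy of the sampling independent of the algorithm's iterates; expectations are taken over it as well. *)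

(* Defs.v *)
From HB Require Import structures.
From mathcomp Require Import all_boot all_order all_algebra.
From mathcomp Require Import all_classical all_reals all_analysis.

Set Implicit Arguments.
Unset Strict Implicit.
Unset Printing Implicit Defensive.

Import Order.TTheory GRing.Theory Num.Theory.
Import numFieldNormedType.Exports.

Local Open Scope classical_set_scope.
Local Open Scope ring_scope.

Definition minimizer (R : realType) (T : Type) (F : T -> \bar R) (x : T)
    : Prop :=
  forall y, (F x <= F y)%E.

Section Euclidean.
Context {R : realType} {d : nat}.
Implicit Types (x y : 'cV[R]_d) (f : 'cV[R]_d -> R) (psi : 'cV[R]_d -> \bar R).

Definition dot x y : R := \sum_i x i 0 * y i 0.

Definition sqnorm x : R := dot x x.

Definition grad f x : 'cV[R]_d := \col_j 'D_(delta_mx j 0) f x.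

Definition convex_on_space f : Prop :=
  convex_function (E := 'cV[R]_d) [set: 'cV[R]_d] f.

Definition proper_closed_convex psi : Prop :=
  [/\ forall x, psi x != -oo%E,
      exists x, psi x != +oo%E,
      closed [set z : 'cV[R]_d * R | (psi z.1 <= z.2%:E)%E] &
      forall x y (t : R), 0 <= t <= 1 ->
        (psi (t *: x + (1 - t) *: y)%R <= t%:E * psi x + (1 - t)%:E * psi y)%E].

Definition prox psi (eta : R) x : 'cV[R]_d :=
  xget 0 [set y | minimizer
    (fun z => ((2 * eta)^-1 * sqnorm (x - z))%:E + psi z)%E y].

End Euclidean.

Section Objective.
Context {R : realType} {n d : nat}.
Variable f_ : 'I_n -> 'cV[R]_d -> R.

Definition average (x : 'cV[R]_d) : R := n%:R^-1 * \sum_i f_ i x.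

Definition objective (psi : 'cV[R]_d -> \bar R) (x : 'cV[R]_d) : \bar R :=
  ((average x)%:E + psi x)%E.

                                                                     
Definition gradmx (x : 'cV[R]_d) : 'M[R]_(d, n) :=
  \matrix_(i, j) grad (f_ j) x i 0.

Definition ones : 'cV[R]_n := const_mx 1.

End Objective.
Arguments ones {R n}.

                                                                           
                                                                            
                                                                  
Inductive sampling (R : realType) (n : nat) : Type :=
| Proper (theta : {set 'I_n} -> 'I_n -> R)
| WithReplacement (tau : nat) (q : 'I_n -> R).

Section Sampling.
Context {R : realType} {n : nat}.

Definition outcome (s : sampling R n) : finType :=
  match s with
  | Proper _ => {set 'I_n}
  | WithReplacement tau _ => tau.-tuple 'I_n
  end.

Definition weight (s : sampling R n) : outcome s -> 'I_n -> R :=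
  match s return outcome s -> 'I_n -> R with
  | Proper theta => fun C i => theta C i
  | WithReplacement tau q => fun _ i => (tau%:R * q i)^-1
  end.

Definition copies (s : sampling R n) : outcome s -> 'I_n -> nat :=
  match s return outcome s -> 'I_n -> nat with
  | Proper _ => fun C i => (i \in C)
  | WithReplacement _ _ => fun t i => count_mem i t
  end.

                                            
Definition thetamx (s : sampling R n) (C : outcome s) : 'M[R]_n :=
  diag_mx (\row_i weight C i).

Definition Imx (s : sampling R n) (C : outcome s) : 'M[R]_n :=
  diag_mx (\row_i (copies C i)%:R).

Definition sampled {d : nat} (s : sampling R n) (C : outcome s)
    (M : 'M[R]_(d, n)) : 'cV[R]_d :=
  n%:R^-1 *: (M *m thetamx C *m Imx C *m ones).

End Sampling.

Section Probability.
Context {R : realType} {disp : measure_display} {Omega : measurableType disp}.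
Variable mu : probability Omega R.

Definition expectation_mx (m n : nat) (M : Omega -> 'M[R]_(m, n))
    : 'M[R]_(m, n) :=
  \matrix_(i, j) fine ('E_mu[fun w => M w i j])%E.

                                                                         
                                                                              
                                                               
Definition cond_expectation (T : Type) (Z : Omega -> T) (Y : Omega -> \bar R)
    (w : Omega) : \bar R :=
  let A := [set v | Z v = Z w] in
  ((fine (mu A))^-1%:E * \int[mu]_(v in A) Y v)%E.

                                                                           
Definition events_of (T : Type) (X : Omega -> T) : set (set Omega) :=
  [set X @^-1` B | B in [set: set T]].

Definition discrete_rv (T : Type) (X : Omega -> T) : Prop :=
  events_of X `<=` measurable.

Definition mutually_independent (I : eqType) (F : I -> set (set Omega)) : Prop :=
  forall (J : seq I) (A : I -> set Omega), uniq J ->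
    (forall i, i \in J -> F i (A i)) ->
    mu [set w | forall i, i \in J -> A i w] = (\prod_(i <- J) mu (A i))%E.

Definition same_law (T : Type) (X Y : Omega -> T) : Prop :=
  forall t, mu [set w | X w = t] = mu [set w | Y w = t].

Context {n : nat}.

Definition follows_sampling (s : sampling R n) : (Omega -> outcome s) -> Prop :=
  match s return (Omega -> outcome s) -> Prop with
  | Proper _ => fun S => forall i, (0 < mu [set w | i \in S w])%E
  | WithReplacement tau q => fun S =>
      [/\ (0 < tau)%N, forall i, 0 < q i, \sum_i q i = 1 &
          forall t : tau.-tuple 'I_n,
            mu [set w | S w = t] = (\prod_(j < tau) q (tnth t j))%:E]
  end.

                                                                               
                                                
Definition draws (s : sampling R n) (S : Omega -> outcome s)
    (S_ : nat -> Omega -> outcome s) (coin : nat -> Omega -> bool)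
    (i : option nat + nat) : set (set Omega) :=
  match i with
  | inl None => events_of S
  | inl (Some k) => events_of (S_ k)
  | inr k => events_of (coin k)
  end.

Record lsvrg_randomness (s : sampling R n) (p : R) (S : Omega -> outcome s)
    (S_ : nat -> Omega -> outcome s) (coin : nat -> Omega -> bool) : Prop := {
  lr_S_rv : discrete_rv S;
  lr_Sk_rv : forall k, discrete_rv (S_ k);
  lr_coin_rv : forall k, discrete_rv (coin k);
  lr_S_law : follows_sampling S;
  lr_S_unbiased :
    expectation_mx (fun w => thetamx (S w) *m Imx (S w)) *m ones = ones :> 'cV[R]_n;
  lr_Sk_law : forall k, same_law (S_ k) S;
  lr_coin_law : forall k, mu [set w | coin k w] = p%:E;
  lr_indep : mutually_independent (draws S S_ coin)
}.

End Probability.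

Section LSVRG.
Context {R : realType} {n d : nat} {Omega : Type}.
Variables (f_ : 'I_n -> 'cV[R]_d -> R) (psi : 'cV[R]_d -> \bar R).
Variables (eta : R) (x0 : 'cV[R]_d) (s : sampling R n).
Variables (S_ : nat -> Omega -> outcome s) (coin : nat -> Omega -> bool).

Definition lsvrg_step (C : outcome s) (b : bool) (xw : 'cV[R]_d * 'cV[R]_d)
    : 'cV[R]_d * 'cV[R]_d :=
  let: (x, w) := xw in
  let g := sampled C (gradmx f_ x - gradmx f_ w)
           + n%:R^-1 *: (gradmx f_ w *m ones) in
  (prox psi eta (x - eta *: g), if b then x else w).

                          
Fixpoint lsvrg (k : nat) (o : Omega) : 'cV[R]_d * 'cV[R]_d :=
  match k with
  | 0%N => (x0, x0)
  | k'.+1 => lsvrg_step (S_ k' o) (coin k' o) (lsvrg k' o)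
  end.

Definition lsvrg_x (k : nat) (o : Omega) : 'cV[R]_d := (lsvrg k o).1.

Definition lsvrg_w (k : nat) (o : Omega) : 'cV[R]_d := (lsvrg k o).2.

Definition lsvrg_mean (k : nat) (o : Omega) : 'cV[R]_d :=
  k.+1%:R^-1 *: \sum_(i < k.+1) lsvrg_x i o.

Variables (S : Omega -> outcome s) (xstar : 'cV[R]_d).

Definition lsvrg_H (k : nat) (o : Omega) : R :=
  sqnorm (sampled (S o) (gradmx f_ (lsvrg_w k o) - gradmx f_ xstar)).

Definition lsvrg_Psi (p : R) (k : nat) (o : Omega) : R :=
  let alpha := 6 * eta / (5 * p) in
  (2 * eta)^-1 * sqnorm (lsvrg_x k o - xstar) + alpha * lsvrg_H k o.

End LSVRG.

(* Main.v *)
Require Import Defs.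
From HB Require Import structures.
From mathcomp Require Import all_boot all_order all_algebra.
From mathcomp Require Import all_classical all_reals all_analysis.
From mathcomp Require Import measurable_realfun ring lra.

Set Implicit Arguments.
Unset Strict Implicit.
Unset Printing Implicit Defensive.

Import Order.TTheory GRing.Theory Num.Theory.
Import numFieldNormedType.Exports.

Local Open Scope classical_set_scope.
Local Open Scope ring_scope.

(** The argument has a deterministic, a probabilistic and a summation part.

    One step from fixed points (x, w), with xs the minimizer.  The optimality
    condition of the proximal step, the convexity of f and its smoothness bound
    P(x') - P(xs), where x' is the proximal point for the direction g
    ([prox_gradient_step]).  The directions g_C average to the gradient of f at
    x, so that after averaging over the outcomes C and applying Young's
    inequality only the variance of g remains
    ([prox_gradient_expected]).  The variance is at most 2 h(x) + 2 h(w), where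
    h(y) is the mean of |1/n (G(y) - G(xs)) theta_C I_C e|^2.  Expected
    smoothness gives h(x) <= 2 L1 (P(x) - P(xs)), because the Bregman distance
    of f to the minimizer is at most the optimality gap.  The weight
    alpha = 6 eta / (5 p) is chosen so that alpha p is exactly the coefficient
    of h in the error.  The coin flip turns alpha h(w) into
    alpha (p h(x) + (1 - p) h(w)), which cancels the h(w) in the error; the
    condition eta L1 <= 1/8 bounds the rest by 3/5 (P(x) - P(xs))
    ([lsvrg_step_decrease]).

    Randomness.  Sampling outcomes and coins live in finite types, so all
    integrals are finite sums.  The state after k steps is a function of the
    finite history of the first k draws, and mutual independence makes the law
    of the history, the next draw, the next coin and the copy S a product
    ([mass_hist_fresh]).  Hence the one-step inequality integrates over any
    event determined by the history ([past_decrease]).  The events on which the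
    k-th state has a given value give the conditional inequality; the whole
    space gives its unconditional form.

    Summation.  The unconditional inequalities telescope
    ([telescoped_sum_le]), and Jensen's inequality passes to the average of the
    iterates ([integral_gap_mean_le]).  For the complexity bound
    C(a, b) = 10 a + 13/4 b works, because 1 <= 1/p.

    Existence of proximal points is part of the proof: the minimizer of P
    provides an affine minorant of psi ([psi_minorant]), so the proximal
    objective is bounded below; by strong convexity its minimizing sequences
    are Cauchy, and closedness of the epigraph of psi makes their limit a
    minimizer ([prox_objective_attained]). *)

(** * Euclidean space and convex functions *)

Section Euclid.
Context {R : realType} {d : nat}.
Implicit Types (x y z v : 'cV[R]_d) (f : 'cV[R]_d -> R) (psi : 'cV[R]_d -> \bar R).

Lemma dotC x y : dot x y = dot y x.
Proof. by apply: eq_bigr => i _; rewrite mulrC. Qed.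

Lemma dotDl x y z : dot (x + y) z = dot x z + dot y z.
Proof. by rewrite -big_split /=; apply: eq_bigr => i _; rewrite mxE mulrDl. Qed.

Lemma dotZl a x y : dot (a *: x) y = a * dot x y.
Proof. by rewrite mulr_sumr; apply: eq_bigr => i _; rewrite mxE mulrA. Qed.

Lemma dotNl x y : dot (- x) y = - dot x y.
Proof. by rewrite -scaleN1r dotZl mulN1r. Qed.

Lemma dotDr x y z : dot z (x + y) = dot z x + dot z y.
Proof. by rewrite !(dotC z) dotDl. Qed.

Lemma dotZr a x y : dot y (a *: x) = a * dot y x.
Proof. by rewrite !(dotC y) dotZl. Qed.

Lemma dotNr x y : dot y (- x) = - dot y x.
Proof. by rewrite !(dotC y) dotNl. Qed.

Lemma dot0l x : dot 0 x = 0.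
Proof. by rewrite -(scale0r 0) dotZl mul0r. Qed.

Definition dotE := (dotDl, dotDr, dotNl, dotNr, dotZl, dotZr).

Lemma dot_suml (I : Type) (r : seq I) (F : I -> 'cV[R]_d) y :
  dot (\sum_(i <- r) F i) y = \sum_(i <- r) dot (F i) y.
Proof.
elim: r => [|i r IH]; first by rewrite !big_nil dot0l.
by rewrite !big_cons dotDl IH.
Qed.

Lemma sqnorm_ge0 x : 0 <= sqnorm x.
Proof. by apply: sumr_ge0 => i _; rewrite -expr2 sqr_ge0. Qed.

Lemma sqr_coord_le_sqnorm x i : x i 0 ^+ 2 <= sqnorm x.
Proof.
rewrite /sqnorm /dot (bigD1 i) //= -expr2 lerDl.
by apply: sumr_ge0 => j _; rewrite -expr2 sqr_ge0.
Qed.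

Lemma sqnormD x y : sqnorm (x + y) = sqnorm x + 2 * dot x y + sqnorm y.
Proof. by rewrite /sqnorm !dotE (dotC y x); ring. Qed.

Lemma sqnormB x y : sqnorm (x - y) = sqnorm x - 2 * dot x y + sqnorm y.
Proof. by rewrite /sqnorm !dotE (dotC y x); ring. Qed.

Lemma sqnormZ a x : sqnorm (a *: x) = a ^+ 2 * sqnorm x.
Proof. by rewrite /sqnorm !dotE; ring. Qed.

Lemma sqnormN x : sqnorm (- x) = sqnorm x.
Proof. by rewrite /sqnorm !dotE; ring. Qed.

Lemma young (b : R) x y : 0 < b ->
  dot x y <= (2 * b)^-1 * sqnorm x + b / 2 * sqnorm y.
Proof.
move=> b0; have := sqnorm_ge0 (x - b *: y).
rewrite sqnormB sqnormZ dotZr => h.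
rewrite -subr_ge0 (_ : _ - _ =
  (2 * b)^-1 * (sqnorm x - 2 * (b * dot x y) + b ^+ 2 * sqnorm y)); last first.
  by field; rewrite gt_eqF.
by rewrite mulr_ge0 // invr_ge0 mulr_ge0 // ltW.
Qed.

Lemma sqnormB_le2 x y : sqnorm (x - y) <= 2 * sqnorm x + 2 * sqnorm y.
Proof.
have := sqnorm_ge0 (x + y); rewrite sqnormB sqnormD; lra.
Qed.

(** Convexity with a real parameter instead of a bundled element of the unit interval. *)
Lemma convex_on_spaceP f : convex_on_space f ->
  forall x y (t : R), 0 <= t <= 1 ->
  f (t *: x + (1 - t) *: y) <= t * f x + (1 - t) * f y.
Proof.
move=> cf x y t t01.
have := cf (Itv01 (andP t01).1 (andP t01).2) x y.
by rewrite !inE => /(_ I I).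
Qed.

(** A linear upper bound on the increments of [f] along [v] bounds the directional
    derivative; all first-order conditions below are instances. *)
Lemma derive_le_slope f x v (c : R) : differentiable f x ->
  (forall t : R, 0 < t <= 1 -> f (x + t *: v) - f x <= t * c) ->
  'D_v f x <= c.
Proof.
move=> /diff_derivable df H.
have /cvg_dnbhs_at_right h : h^-1 *: ((f \o shift x) (h *: v) - f x) @[h --> 0^'] --> 'D_v f x.
  exact: df.
rewrite -(cvg_lim _ h)//; apply: limr_le; first by apply/cvg_ex; exists ('D_v f x).
near=> t.
have t0 : 0 < t by near: t; exact: nbhs_right_gt.
rewrite /= /GRing.scale /= ler_pdivrMl // [_ + x]addrC; apply: H.
by rewrite t0 /=; near: t; apply: nbhs_right_le.
Unshelve. all: by end_near. Qed.

Lemma dot_grad f x v : differentiable f x -> dot (grad f x) v = 'D_v f x.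
Proof.
move=> df; rewrite deriveE //.
rewrite [v in RHS]matrix_sum_delta linear_sum; apply: eq_bigr => i _.
by rewrite big_ord1 linearZ /= mxE deriveE // mulrC.
Qed.

Lemma convex_grad_le f x y : differentiable f x -> convex_on_space f ->
  f x + dot (grad f x) (y - x) <= f y.
Proof.
move=> df cf; rewrite dot_grad // addrC -lerBrDr; apply: derive_le_slope => // t /andP[t0 t1].
have := convex_on_spaceP cf y x (t := t); rewrite (ltW t0) t1 => /(_ isT).
rewrite (_ : t *: y + (1 - t) *: x = x + t *: (y - x)); first lra.
by rewrite scalerBr scalerBl scale1r addrCA.
Qed.

Lemma derive_le_slopeN f x v (c : R) : differentiable f x ->
  (forall t : R, 0 < t <= 1 -> f x - f (x + t *: v) <= t * c) ->
  - 'D_v f x <= c.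
Proof.
move=> df H; rewrite -deriveN; last exact: diff_derivable.
apply: derive_le_slope; first exact: differentiableN.
move=> t /H; rewrite -[(- f) _]/(- f _) -[(- f) _]/(- f _) opprK addrC.
by [].
Qed.

Lemma smooth_upper f (L : R) x y : 0 <= L -> differentiable f x ->
  convex_on_space (fun y => L / 2 * sqnorm y - f y) ->
  f y <= f x + dot (grad f x) (y - x) + L / 2 * sqnorm (y - x).
Proof.
move=> L0 df cg; set v := y - x.
suff : - 'D_v f x <= f x - f y + L / 2 * sqnorm v by rewrite dot_grad //; lra.
have yE : y = x + v by rewrite /v addrC subrK.
apply: derive_le_slopeN => // t /andP[t0 t1].
have := convex_on_spaceP cg y x (t := t); rewrite (ltW t0) t1 => /(_ isT).
rewrite (_ : t *: y + (1 - t) *: x = x + t *: v); last first.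
  by rewrite /v scalerBr scalerBl scale1r addrCA.
rewrite yE !sqnormD sqnormZ dotZr -yE.
have : 0 <= L / 2 * (t ^+ 2 * sqnorm v).
  by rewrite mulr_ge0 ?divr_ge0 // mulr_ge0 ?sqr_ge0 ?sqnorm_ge0.
lra.
Qed.
End Euclid.

(** * The proximal operator *)

Section Prox.
Context {R : realType} {d : nat}.
Implicit Types (x y z v u : 'cV[R]_d) (f : 'cV[R]_d -> R) (psi : 'cV[R]_d -> \bar R).

Lemma psi_convex_le psi x y (a b t : R) : proper_closed_convex psi ->
  0 <= t <= 1 -> (psi x <= a%:E)%E -> (psi y <= b%:E)%E ->
  (psi (t *: x + (1 - t) *: y)%R <= (t * a + (1 - t) * b)%:E)%E.
Proof.
move=> [_ _ _ cpsi] t01 xa yb; apply: (le_trans (cpsi x y t t01)).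
case/andP: t01 => t0 t1.
rewrite (EFinD (t * a)) !EFinM; apply: leeD; apply: lee_wpmul2l => //.
by rewrite lee_fin subr_ge0.
Qed.

(** Comparison with the midpoint: for a convex [psi], points that minimize
    kappa |u - z|^2 + psi(z) up to [e] and [e'] are close to each other. *)
Lemma near_minimizers_close (kappa m e e' : R) psi u y y' :
  proper_closed_convex psi ->
  (forall r z, (psi z <= (r - kappa * sqnorm (u - z))%:E)%E -> m <= r) ->
  (psi y <= (m + e - kappa * sqnorm (u - y))%:E)%E ->
  (psi y' <= (m + e' - kappa * sqnorm (u - y'))%:E)%E ->
  kappa * sqnorm (y - y') <= 2 * (e + e').
Proof.
move=> cpsi lbm hy hy'.
have h01 : 0 <= (2^-1 : R) <= 1 by lra.
have := psi_convex_le cpsi h01 hy hy'.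
set mid := _ *: y + _ *: y'.
set r := (X in (_ <= X%:E)%E) => h.
have : m <= r + kappa * sqnorm (u - mid) by apply: (lbm _ mid); rewrite addrK.
have -> : u - mid = 2^-1 *: ((u - y) + (u - y')).
  by rewrite /mid; apply/matrixP => i j; rewrite !mxE; field.
have -> : y - y' = (u - y') - (u - y).
  by apply/matrixP => i j; rewrite !mxE; ring.
rewrite /r sqnormZ (sqnormD (u - y)) (sqnormB (u - y')) (dotC (u - y')) => {h}.
lra.
Qed.

Lemma coord_cvg (y_ : nat -> 'cV[R]_d) y i :
  y_ @ \oo --> y -> y_ k i 0 @[k --> \oo] --> y i 0.
Proof.
move=> cy; apply: (cvg_comp y_ (fun N : 'cV[R]_d => N i 0 : R)) cy _.
by have /differentiable_continuous := differentiable_coord y i 0.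
Qed.

Lemma sqnorm_cvg (y_ : nat -> 'cV[R]_d) y :
  y_ @ \oo --> y -> sqnorm (y_ k) @[k --> \oo] --> sqnorm y.
Proof.
move=> cy; apply: cvg_big => [|i _]; first exact: add_continuous.
by apply: cvgM; exact: coord_cvg.
Qed.

Lemma sqnorm_cauchy_cvg (y_ : nat -> 'cV[R]_d) :
  (forall e : R, 0 < e ->
    exists N, forall k, (N <= k)%N -> sqnorm (y_ N - y_ k) < e) ->
  cvg (y_ @ \oo).
Proof.
move=> H; apply: mx_complete; apply/cauchyP => e e0.
have [N HN] := H (e ^+ 2) (exprn_gt0 _ e0).
exists (y_ N); exists N => // k /= Nk; split=> // i j; rewrite ord1 /ball /=.
rewrite -ltr_sqr ?nnegrE ?normr_ge0 ?(ltW e0) // real_normK ?num_real //.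
apply: le_lt_trans (HN _ Nk).
by have := sqr_coord_le_sqnorm (y_ N - y_ k) i; rewrite !mxE.
Qed.

(** A minimizing sequence is Cauchy by [near_minimizers_close]; its limit is a
    minimizer since the epigraph of [psi] is closed. *)
Lemma prox_objective_attained psi (eta c : R) (a u : 'cV[R]_d) :
  proper_closed_convex psi -> 0 < eta ->
  (forall y, (dot a y + c)%:E <= psi y)%E ->
  exists z, minimizer
    (fun z => ((2 * eta)^-1 * sqnorm (u - z))%:E + psi z)%E z.
Proof.
move=> pcc eta0 lbpsi; set kappa := (2 * eta)^-1.
have k0 : 0 < kappa by rewrite invr_gt0 mulr_gt0.
(* the values that bound the proximal objective somewhere from above *)
pose V := [set r : R | exists z, (psi z <= (r - kappa * sqnorm (u - z))%:E)%E].
have lbV : lbound V (dot a u + c - (4 * kappa)^-1 * sqnorm a).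
  move=> r [z hz]; have := le_trans (lbpsi z) hz; rewrite lee_fin => h.
  have k20 : 0 < 2 * kappa by lra.
  have := young a (u - z) k20; rewrite dotDr dotNr mulrA.
  rewrite (_ : 2 * 2 * kappa = 4 * kappa); last by ring.
  rewrite (_ : 2 * kappa / 2 = kappa); last by field.
  lra.
have V0 : V !=set0.
  have [_ [z zoo] _ _] := pcc; have [nNy _ _ _] := pcc.
  have zf : psi z \is a fin_num by rewrite fin_numE nNy.
  exists (fine (psi z) + kappa * sqnorm (u - z)); exists z.
  by rewrite addrK fineK.
have infV : has_inf V by split => //; eexists; exact: lbV.
set m := inf V.
have mle r z : (psi z <= (r - kappa * sqnorm (u - z))%:E)%E -> m <= r.
  by move=> h; apply: ge_inf; [exact: infV.2|exists z].
have /choice[y_ hy] : forall k : nat, exists z,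
    (psi z <= (m + k.+1%:R^-1 - kappa * sqnorm (u - z))%:E)%E.
  move=> k; have h : 0 < k.+1%:R^-1 :> R by rewrite invr_gt0.
  have [r [z hz] hr] := inf_adherent h infV.
  by exists z; apply: (le_trans hz); rewrite lee_fin lerD2r ltW.
have cy : cvg (y_ @ \oo).
  apply: sqnorm_cauchy_cvg => e e0.
  have [N HN] : exists N : nat, 4 * (kappa^-1 * N.+1%:R^-1) < e.
    (* the integer part plus one exceeds its argument *)
    exists (Num.truncn (4 / (kappa * e))).
    have := truncnS_gt (4 / (kappa * e)).
    rewrite ltr_pdivrMr ?mulr_gt0 // => h.
    rewrite mulrA ltr_pdivrMr // mulrA in h *.
    rewrite -(ltr_pM2l k0) mulrCA mulfV ?gt_eqF// mulr1 mulrA (mulrC kappa).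
    by rewrite -mulrA mulrC mulrA; lra.
  exists N => k Nk.
  have := near_minimizers_close pcc mle (hy N) (hy k).
  rewrite -ler_pdivlMl // => h; apply: le_lt_trans h _; apply: le_lt_trans HN.
  rewrite [leRHS]mulrCA; apply: ler_wpM2l; first by rewrite invr_ge0 ltW.
  have : k.+1%:R^-1 <= N.+1%:R^-1 :> R by rewrite lef_pV2 ?posrE// ler_nat.
  by move: (k.+1%:R^-1) (N.+1%:R^-1) => a' b' h; lra.
have [y yE] : exists y, y_ @ \oo --> y by apply/cvg_ex.
(* the points [F k] lie in the closed epigraph of [psi]; so does their limit *)
have hpsi : (psi y <= (m - kappa * sqnorm (u - y))%:E)%E.
  have [_ _ cl _] := pcc.
  pose F k : 'cV[R]_d * R := (y_ k, m + k.+1%:R^-1 - kappa * sqnorm (u - y_ k)).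
  have hF : \forall k \near \oo, [set z : 'cV[R]_d * R | (psi z.1 <= z.2%:E)%E] (F k).
    by near=> k; exact: hy.
  have h1 : m + k.+1%:R^-1 - kappa * sqnorm (u - y_ k) @[k --> \oo] -->
      m - kappa * sqnorm (u - y).
    apply: cvgB.
      rewrite -[X in _ --> X]addr0; apply: cvgD; first exact: cvg_cst.
      exact: cvg_harmonic.
    by apply: cvgMl_tmp; apply: sqnorm_cvg; apply: cvgB => //; exact: cvg_cst.
  have h2 : F @ \oo --> (y, m - kappa * sqnorm (u - y)).
    exact: (cvg_pair yE h1).
  exact: (closed_cvg _ cl hF (y, m - kappa * sqnorm (u - y)) h2).
exists y => z.
apply: (@le_trans _ _ m%:E).
  have [nNy _ _ _] := pcc.
  have yf : psi y \is a fin_num.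
    by rewrite fin_numE nNy /= -ltey (le_lt_trans hpsi) ?ltry.
  by rewrite -(fineK yf) -EFinD lee_fin; move: hpsi; rewrite -{1}(fineK yf) lee_fin; lra.
have [nNy _ _ _] := pcc; have := nNy z; case E : (psi z) => [r| |] // _.
  rewrite -EFinD lee_fin; apply: (mle _ z); rewrite E lee_fin; lra.
by rewrite addeC addye// leey.
Unshelve. all: by end_near. Qed.

(** The optimality condition of the proximal point: (u - prox(u)) / eta is a
    subgradient of [psi] at prox(u). *)
Lemma prox_variational psi (eta c : R) (a u : 'cV[R]_d) :
  proper_closed_convex psi -> 0 < eta ->
  (forall y, (dot a y + c)%:E <= psi y)%E ->
  exists2 b : R, psi (prox psi eta u) = b%:E &
    forall y b', (psi y <= b'%:E)%E ->
    b + eta^-1 * dot (u - prox psi eta u) (y - prox psi eta u) <= b'.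
Proof.
move=> pcc eta0 lbpsi.
have /xgetPex - /(_ 0) := prox_objective_attained u pcc eta0 lbpsi.
rewrite -/(prox psi eta u); set z := prox psi eta u => zmin.
have [nNy [x0 px0] _ _] := pcc.
have [b zb] : exists b, psi z = b%:E.
  have := zmin x0; have := nNy z; case: (psi z) => [r| |] // _; first by exists r.
  rewrite addeC addye //; have := nNy x0; move: px0; by case: (psi x0).
exists b => // y b' yb'.
rewrite -lerBrDl; set v := y - z.
(* compare [z] with the points of the segment towards [y], then let t -> 0 *)
have key (t : R) : 0 < t <= 1 ->
    eta^-1 * dot (u - z) v <= b' - b + t * ((2 * eta)^-1 * sqnorm v).
  move=> /andP[t0 t1]; have t01 : 0 <= t <= 1 by rewrite ltW.
  have bb : (psi z <= b%:E)%E by rewrite zb.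
  have h := psi_convex_le pcc t01 yb' bb.
  have zv : t *: y + (1 - t) *: z = z + t *: v.
    by rewrite /v scalerBr scalerBl scale1r addrCA.
  rewrite zv in h.
  have := le_trans (zmin (z + t *: v)) (leeD2l _ h).
  have -> : u - (z + t *: v) = (u - z) - t *: v by rewrite opprD addrA.
  rewrite zb -!EFinD lee_fin (sqnormB (u - z)) sqnormZ dotZr.
  rewrite invfM => h'.
  rewrite -(ler_pM2l t0); lra.
apply/ler_addgt0Pr => e e0.
set K := (2 * eta)^-1 * sqnorm v in key *.
have K0 : 0 <= K by rewrite mulr_ge0 ?sqnorm_ge0 // invr_ge0; lra.
pose t := Num.min 1 (e / (K + 1)).
have tK : t * K <= e.
  have : t <= e / (K + 1) by rewrite ge_min lexx orbT.
  rewrite ler_pdivlMr; last lra.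
  have : 0 <= t by rewrite le_min ler01 divr_ge0 // ?ltW//; lra.
  nra.
have := key t; rewrite ge_min lexx /= lt_min ltr01 divr_gt0 //; last lra.
by move=> /(_ isT); lra.
Qed.

(** At a minimizer of f + psi, minus the gradient of [f] is a subgradient of [psi]. *)
Lemma minimizer_subgradient f psi xs y (a b : R) :
  proper_closed_convex psi ->
  differentiable f xs -> minimizer (fun x => (f x)%:E + psi x)%E xs ->
  psi xs = a%:E -> (psi y <= b%:E)%E -> a <= b + dot (grad f xs) (y - xs).
Proof.
move=> pcc df ms xa yb; rewrite dot_grad //; set v := y - xs.
suff : - 'D_v f xs <= b - a by lra.
apply: derive_le_slopeN => // t /andP[t0 t1].
have t01 : 0 <= t <= 1 by rewrite ltW.
have h : (psi xs <= a%:E)%E by rewrite xa.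
have {h}h := psi_convex_le pcc t01 yb h.
have zv : t *: y + (1 - t) *: xs = xs + t *: v.
  by rewrite /v scalerBr scalerBl scale1r addrCA.
rewrite zv in h.
have := le_trans (ms (xs + t *: v)) (leeD2l _ h).
rewrite xa -!EFinD lee_fin; lra.
Qed.

End Prox.

(** * A proximal gradient step in a random direction *)

Section FiniteExpectation.
Context {R : realType} {d : nat} {O : finType} (q : O -> R).
Implicit Types (Z : O -> 'cV[R]_d).

(** The variance is at most the second moment. *)
Lemma sqnorm_deviation_le Z (m : 'cV[R]_d) : \sum_C q C = 1 ->
  \sum_C q C *: Z C = m ->
  \sum_C q C * sqnorm (Z C - m) <= \sum_C q C * sqnorm (Z C).
Proof.
move=> q1 mE.
have -> : \sum_C q C * sqnorm (Z C - m) =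
    \sum_C q C * sqnorm (Z C) - sqnorm m; last by rewrite lerBlDr lerDl sqnorm_ge0.
transitivity (\sum_C (q C * sqnorm (Z C) - 2 * dot (q C *: Z C) m + q C * sqnorm m)).
  by apply: eq_bigr => C _; rewrite sqnormB dotZl; ring.
rewrite big_split sumrB /= -mulr_suml q1 -mulr_sumr -dot_suml mE /sqnorm; ring.
Qed.

End FiniteExpectation.

Section ProxGradient.
Context {R : realType} {d : nat}.
Context {f : 'cV[R]_d -> R} {psi : 'cV[R]_d -> \bar R} {eta Lf c : R}.
Context {av : 'cV[R]_d}.
Context (df : forall x, differentiable f x) (cf : convex_on_space f).
Context (Lf0 : 0 <= Lf) (cg : convex_on_space (fun y => Lf / 2 * sqnorm y - f y)).
Context (pcc : proper_closed_convex psi) (eta0 : 0 < eta).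
Context (minorant : forall y, ((dot av y + c)%:E <= psi y)%E).

(** The deterministic descent inequality for an arbitrary direction [g]. *)
Lemma prox_gradient_step (x g y : 'cV[R]_d) (b : R) : (psi y <= b%:E)%E ->
  let x' := prox psi eta (x - eta *: g) in
  exists2 b', psi x' = b'%:E &
  f x' + b' <= f y + b + dot (grad f x - g) (x' - y)
    + (2 * eta)^-1 * (sqnorm (x - y) - sqnorm (x' - y))
    - ((2 * eta)^-1 - Lf / 2) * sqnorm (x' - x).
Proof.
move=> yb x'.
have [b' x'b H] := prox_variational (x - eta *: g) pcc eta0 minorant.
exists b' => //; rewrite -/x' in H.
have h1 := smooth_upper (x := x) x' Lf0 (df x) cg.
have h2 := convex_grad_le (x := x) y (df x) cf.
have {H} := H y b yb.
have -> : eta^-1 * dot (x - eta *: g - x') (y - x') =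
    (2 * eta)^-1 * (sqnorm (x' - x) + sqnorm (x' - y) - sqnorm (x - y))
    + dot g (x' - y).
  rewrite /sqnorm !dotE (dotC x' x) (dotC y x) (dotC y x') .
  by field; rewrite gt_eqF.
have -> : dot (grad f x - g) (x' - y) =
    dot (grad f x) (x' - x) - dot (grad f x) (y - x) - dot g (x' - y).
  rewrite !dotE; ring.
lra.
Qed.

(** The descent inequality averaged over directions [g C] with mean the gradient.
    The inner product with x - y vanishes in the mean, and Young's inequality with
    parameter 5 / (6 eta) absorbs the remaining one. *)
Lemma prox_gradient_expected {O : finType} (q : O -> R) (g : O -> 'cV[R]_d)
    (x y : 'cV[R]_d) (b : R) :
  eta * Lf <= 6^-1 -> (psi y <= b%:E)%E ->
  (forall C, 0 <= q C) -> \sum_C q C = 1 -> \sum_C q C *: g C = grad f x ->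
  let x' C := prox psi eta (x - eta *: g C) in
  (forall C, exists b', psi (x' C) = b'%:E) /\
  \sum_C q C * (f (x' C) + fine (psi (x' C))) - (f y + b) <=
    (2 * eta)^-1 * sqnorm (x - y)
    - \sum_C q C * ((2 * eta)^-1 * sqnorm (x' C - y))
    + 3 / 5 * eta * \sum_C q C * sqnorm (g C - grad f x).
Proof.
move=> etaLf yb q0 q1 Eg x'.
have H C := prox_gradient_step x (g C) yb.
split; first by move=> C; have [b' ? _] := H C; exists b'.
have -> : f y + b = \sum_C q C * (f y + b) by rewrite -mulr_suml q1 mul1r.
have -> : (2 * eta)^-1 * sqnorm (x - y) =
    \sum_C q C * ((2 * eta)^-1 * sqnorm (x - y)) by rewrite -mulr_suml q1 mul1r.
have E0 : \sum_C q C * dot (grad f x - g C) (x - y) = 0.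
  transitivity (dot (\sum_C (q C *: grad f x - q C *: g C)) (x - y)).
    by rewrite dot_suml; apply: eq_bigr => C _; rewrite -scalerBr dotZl.
  by rewrite sumrB -scaler_suml q1 Eg scale1r subrr dot0l.
rewrite -[leRHS]addr0 -[X in _ <= _ + X]E0 (mulr_sumr _ _ _ (3 / 5 * eta)) -!sumrB -!big_split /=.
apply: ler_sum => C _.
rewrite [X in _ + X + _]mulrCA -mulrBr -mulrBr -!mulrDr; apply: ler_wpM2l => //.
have [b' b'E h] := H C; rewrite b'E /=.
set D := (2 * eta)^-1 - Lf / 2 in h.
(* eta Lf <= 1/6 leaves this much of the quadratic term *)
have D0 : 5 / (12 * eta) <= D.
  rewrite -subr_ge0 (_ : D - _ = (6^-1 - eta * Lf) / (2 * eta)).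
    by rewrite divr_ge0 ?mulr_ge0 ?subr_ge0 // ltW.
  by rewrite /D; field; rewrite gt_eqF.
have Y : dot (grad f x - g C) (x' C - x) <=
    3 / 5 * eta * sqnorm (g C - grad f x) + 5 / (12 * eta) * sqnorm (x' C - x).
  have e0 : 0 < 5 / (6 * eta) by rewrite divr_gt0 // mulr_gt0.
  apply: le_trans (young _ _ e0) _.
  rewrite -(sqnormN (g C - _)) opprB.
  rewrite le_eqVlt; apply/orP; left; apply/eqP.
  by field; rewrite gt_eqF.
have s0 := sqnorm_ge0 (x' C - x).
have -> : dot (grad f x - g C) (x - y) =
    dot (grad f x - g C) (x' C - y) - dot (grad f x - g C) (x' C - x).
  rewrite !dotE; ring.
have := ler_wpM2r s0 D0.
by rewrite /x' in Y *; lra.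
Qed.

End ProxGradient.

(** * One step of L-SVRG *)

Section Sampled.
Context {R : realType} {n d : nat} {s : sampling R n}.
Implicit Types (M N : 'M[R]_(d, n)) (C : outcome s).

Lemma sampledB C M N : sampled C (M - N) = sampled C M - sampled C N.
Proof. by rewrite /sampled !mulmxBl scalerBr. Qed.

(** Unbiasedness of the sampled average. *)
Lemma sampled_mean (q : outcome s -> R) M :
  (\sum_C q C *: (thetamx C *m Imx C)) *m ones = ones :> 'cV[R]_n ->
  \sum_C q C *: sampled C M = n%:R^-1 *: (M *m ones).
Proof.
move=> unb; rewrite -[in RHS]unb mulmxA mulmx_sumr mulmx_suml scaler_sumr.
apply: eq_bigr => C _; rewrite /sampled -scalemxAr -scalemxAl !mulmxA.
by rewrite !scalerA mulrC.
Qed.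

End Sampled.

Section Average.
Context {R : realType} {n d : nat} {f_ : 'I_n -> 'cV[R]_d -> R}.
Context (df_ : forall i y, differentiable (f_ i) y).

Lemma averageE : average f_ = n%:R^-1 *: (\sum_i f_ i).
Proof. by apply/funext => x; rewrite /average /= fctE fct_sumE. Qed.

Lemma differentiable_average x : differentiable (average f_) x.
Proof.
by rewrite averageE; apply: differentiableZ; apply: differentiable_sum => i.
Qed.

Lemma grad_average x :
  grad (average f_) x = n%:R^-1 *: (gradmx f_ x *m ones).
Proof.
apply/matrixP => j k; rewrite ord1 /grad averageE !mxE deriveZ; last first.
  by apply: diff_derivable; apply: differentiable_sum => i.
rewrite derive_sum; last by move=> i; exact: diff_derivable.
congr (_ * _); apply: eq_bigr => i _.
by rewrite /gradmx /grad /ones !mxE mulr1.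
Qed.

End Average.

(** The optimality gap P(y) - P(xs), possibly infinite. *)
Definition gap {R : realType} {n d : nat} (f_ : 'I_n -> 'cV[R]_d -> R)
    (psi : 'cV[R]_d -> \bar R) (xs y : 'cV[R]_d) : \bar R :=
  (objective f_ psi y - objective f_ psi xs)%E.

(** The mean, over the law [q] of the sampling, of the quantity H at the reference
    point [y]. *)
Definition meanH {R : realType} {n d : nat} (f_ : 'I_n -> 'cV[R]_d -> R)
    {s : sampling R n} (q : outcome s -> R) (xs y : 'cV[R]_d) : R :=
  \sum_C q C * sqnorm (sampled C (gradmx f_ y - gradmx f_ xs)).

(** The next iterate when the sampling returns [C]; it does not depend on the coin,
    whose value is arbitrarily taken to be [true]. *)
Definition next_x {R : realType} {n d : nat} (f_ : 'I_n -> 'cV[R]_d -> R)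
    (psi : 'cV[R]_d -> \bar R) (eta : R) {s : sampling R n} (C : outcome s)
    (xw : 'cV[R]_d * 'cV[R]_d) : 'cV[R]_d :=
  (lsvrg_step f_ psi eta C true xw).1.

Section Step.
Context {R : realType} {n d : nat} {f_ : 'I_n -> 'cV[R]_d -> R}.
Context {psi : 'cV[R]_d -> \bar R} {s : sampling R n}.
Context {q : outcome s -> R}.
Context {eta p Lf L1 : R} {xs : 'cV[R]_d}.
Local Notation f := (average f_).
Local Notation gap := (gap f_ psi xs).
Local Notation meanH := (meanH f_ q xs).
Local Notation next_x := (@next_x R n d f_ psi eta s).
Context (df_ : forall i y, differentiable (f_ i) y).
Context (pcc : proper_closed_convex psi).
Context (ms : minimizer (objective f_ psi) xs).

Lemma psi_xs_fin : exists a, psi xs = a%:E.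
Proof.
have [nNy [x0 px0] _ _] := pcc.
have := ms x0; have := nNy xs; rewrite /objective.
case: (psi xs) => [r| |] // _; first by exists r.
by rewrite addeC addye //; have := nNy x0; move: px0; case: (psi x0).
Qed.

Lemma gapE y a b : psi xs = a%:E -> psi y = b%:E ->
  gap y = (f y + b - (f xs + a))%:E.
Proof. by move=> xsa yb; rewrite /gap /objective xsa yb. Qed.

Lemma gap_ge0 y : (0 <= gap y)%E.
Proof.
have [a xsa] := psi_xs_fin.
by rewrite /gap sube_ge0 ?ms // /objective xsa.
Qed.

Lemma psi_minorant : exists (av : 'cV[R]_d) c,
  forall y, ((dot av y + c)%:E <= psi y)%E.
Proof.
have [a xsa] := psi_xs_fin; have [nNy _ _ _] := pcc.
exists (- grad f xs), (a + dot (grad f xs) xs) => y.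
have := nNy y; case E : (psi y) => [b| |] // _; last by rewrite leey.
have yb : (psi y <= b%:E)%E by rewrite E.
have := minimizer_subgradient pcc (differentiable_average df_ xs) ms xsa yb.
by rewrite lee_fin dotNl dotDr dotNr; lra.
Qed.

(** The Bregman distance of [f] to the minimizer is at most the optimality gap. *)
Lemma bregman_le_gap y : psi y \is a fin_num ->
  f y - f xs - dot (grad f xs) (y - xs) <= fine (gap y).
Proof.
move=> /fineK /esym yb; have [a xsa] := psi_xs_fin.
rewrite (gapE xsa yb) /=.
have h : (psi y <= (fine (psi y))%:E)%E by rewrite -yb.
have := minimizer_subgradient pcc (differentiable_average df_ xs) ms xsa h.
lra.
Qed.

Lemma gap_fin y : psi y \is a fin_num -> gap y \is a fin_num.
Proof.
by move=> /fineK /esym yb; have [a xsa] := psi_xs_fin; rewrite (gapE xsa yb).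
Qed.

Lemma fine_gap_ge0 y : 0 <= fine (gap y).
Proof. exact/fine_ge0/gap_ge0. Qed.

Context (eta0 : 0 < eta) (p01 : 0 < p <= 1).
Context (cf : convex_on_space f).
Context (Lf0 : 0 < Lf) (cg : convex_on_space (fun y => Lf / 2 * sqnorm y - f y)).
Context (q0 : forall C, 0 <= q C) (q1 : \sum_C q C = 1).
Context (unb : (\sum_C q C *: (thetamx C *m Imx C)) *m ones = ones :> 'cV[R]_n).

Context (L10 : 0 < L1).
Context (expected_smooth : forall y,
  meanH y <= 2 * L1 * (f y - f xs - dot (grad f xs) (y - xs))).

Lemma next_x_fin C xw : psi (next_x C xw) \is a fin_num.
Proof.
have [av [c minor]] := psi_minorant; case: xw => x w.
rewrite /next_x /=; set u := (x - _).
by have [b -> _] := prox_variational u pcc eta0 minor.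
Qed.

Lemma meanH_le_gap y : psi y \is a fin_num -> meanH y <= 2 * L1 * fine (gap y).
Proof.
move=> yfin; apply: le_trans (expected_smooth y) _.
by rewrite ler_pM2l ?mulr_gt0 // bregman_le_gap.
Qed.

(** The expected decrease over one step from the state [(x, w)], where the
    expectation is written as a finite sum over the outcomes. *)
Lemma lsvrg_step_decrease (x w : 'cV[R]_d) (alpha := 6 * eta / (5 * p)) :
  eta <= Num.min (1 / (8 * L1)) (1 / (6 * Lf)) ->
  psi x \is a fin_num ->
  \sum_C q C * fine (gap (next_x C (x, w))) +
  (\sum_C q C * ((2 * eta)^-1 * sqnorm (next_x C (x, w) - xs))
    + alpha * (p * meanH x + (1 - p) * meanH w))
  <= 3 / 5 * fine (gap x) + ((2 * eta)^-1 * sqnorm (x - xs) + alpha * meanH w).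
Proof.
rewrite le_min => /andP[etaL1 etaLf] xfin.
have {}etaL1 : eta * L1 <= 8^-1.
  by move: etaL1; rewrite ler_pdivlMr ?mulr_gt0 // mulrCA -ler_pdivlMl // mulr1.
have {}etaLf : eta * Lf <= 6^-1.
  by move: etaLf; rewrite ler_pdivlMr ?mulr_gt0 // mulrCA -ler_pdivlMl // mulr1.
have [a xsa] := psi_xs_fin; have [av [c minor]] := psi_minorant.
pose g (C : outcome s) := sampled C (gradmx f_ x - gradmx f_ w) + n%:R^-1 *: (gradmx f_ w *m ones).
pose Z (C : outcome s) := sampled C (gradmx f_ x - gradmx f_ w).
have EZ : \sum_C q C *: Z C = grad f x - grad f w.
  by rewrite (sampled_mean _ unb) !(grad_average df_) mulmxBl scalerBr.
have Eg : \sum_C q C *: g C = grad f x.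
  under eq_bigr do rewrite /g scalerDr.
  by rewrite big_split /= EZ -scaler_suml q1 scale1r (grad_average df_ w) subrK.
have xsle : (psi xs <= a%:E)%E by rewrite xsa.
have [_] := prox_gradient_expected (differentiable_average df_) cf (ltW Lf0) cg pcc
  eta0 minor etaLf xsle q0 q1 Eg.
have -> : \sum_C q C * (f (prox psi eta (x - eta *: g C)) +
      fine (psi (prox psi eta (x - eta *: g C)))) - (f xs + a)
    = \sum_C q C * fine (gap (next_x C (x, w))).
  rewrite -[f xs + a]mul1r -q1 mulr_suml -sumrB; apply: eq_bigr => C _.
  have /fineK/esym E := next_x_fin C (x, w).
  by rewrite (gapE xsa E) /= -mulrBr.
have : \sum_C q C * sqnorm (g C - grad f x) <= 2 * meanH x + 2 * meanH w.
  apply: le_trans (_ : _ <= \sum_C q C * sqnorm (Z C)) _.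
    rewrite [leLHS](_ : _ = \sum_C q C * sqnorm (Z C - (grad f x - grad f w))).
      exact: sqnorm_deviation_le.
    by apply: eq_bigr => C _; rewrite /g -(grad_average df_) -addrA opprB.
  rewrite -mulrDr -big_split mulr_sumr /=; apply: ler_sum => C _.
  have ZE : Z C = sampled C (gradmx f_ x - gradmx f_ xs)
      - sampled C (gradmx f_ w - gradmx f_ xs).
    by rewrite -sampledB opprB addrA subrK.
  rewrite -mulrDr (mulrCA 2 (q C)) mulrDr ZE; apply: ler_wpM2l => //.
  exact: sqnormB_le2.
have Hx := meanH_le_gap xfin.
have G0 := fine_gap_ge0 x.
(* the reason for the choice of alpha *)
have ap : alpha * p = 6 / 5 * eta.
  by rewrite /alpha; field; rewrite gt_eqF //; case/andP: p01.
rewrite /next_x /= -/(g _).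
move: Hx G0; set V := \sum_C _; set A := \sum_C _; set B := \sum_C _.
move: V A B alpha ap.
move: (meanH x) (meanH w) (fine (gap x)) (_ * sqnorm _) => hx hw G S.
move=> V A B alpha ap Hx G0 hV h.
have h1 : eta * L1 * G <= 8^-1 * G by exact: ler_wpM2r.
have h2 : eta * V <= eta * (2 * hx + 2 * hw) by rewrite ler_pM2l.
have h3 : eta * hx <= eta * (2 * L1 * G) by rewrite ler_pM2l.
have -> : alpha * (p * hx + (1 - p) * hw) = alpha * hw + 6 / 5 * eta * (hx - hw).
  by rewrite -ap; ring.
lra.
Qed.

End Step.

(** * Discrete random variables *)

Section DiscreteVariables.
Context {R : realType} {disp : measure_display} {Omega : measurableType disp}.
Context (mu : probability Omega R).
Implicit Types (T U : finType).

(** The probability that [X] takes the value [t], as a real number. *)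
Definition mass (T : Type) (X : Omega -> T) (t : T) : R :=
  fine (mu [set o | X o = t]).

Lemma discrete_rv_measurable (T : Type) (X : Omega -> T) (A : set T) :
  discrete_rv X -> measurable [set o | A (X o)].
Proof. by move=> dX; apply: dX; exists A. Qed.

Lemma discrete_rv_measurable_fun (T : Type) (X : Omega -> T) (D : set Omega)
    (phi : T -> \bar R) :
  measurable D -> discrete_rv X -> measurable_fun D (phi \o X).
Proof.
move=> mD dX; apply: (measurable_funS measurableT) => // _ Y mY; rewrite setTI.
exact: (discrete_rv_measurable (phi @^-1` Y)).
Qed.

Lemma discrete_rv_comp (T U : Type) (X : Omega -> T) (phi : T -> U) :
  discrete_rv X -> discrete_rv (phi \o X).
Proof.
move=> dX _ [B _ <-]; exact: (discrete_rv_measurable (phi @^-1` B)).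
Qed.

Lemma finite_discrete_rv T (X : Omega -> T) :
  (forall t, measurable [set o | X o = t]) -> discrete_rv X.
Proof.
move=> mX _ [B _ <-].
rewrite (_ : _ @^-1` _ = \big[setU/set0]_(t <- enum T | `[<B t>]) [set o | X o = t]).
  exact: bigsetU_measurable.
apply/seteqP; split => o /=.
  move=> Bo; rewrite -bigcup_seq_cond /=; exists (X o) => //.
  by apply/andP; split; [rewrite mem_enum|exact/asboolP].
by rewrite -bigcup_seq_cond => -[t /= /andP[_ /asboolP Bt] ->].
Qed.

Lemma discrete_rv_pair T U (X : Omega -> T) (Y : Omega -> U) :
  discrete_rv X -> discrete_rv Y -> discrete_rv (fun o => (X o, Y o)).
Proof.
move=> dX dY; apply: finite_discrete_rv => -[t u].
rewrite (_ : mkset _ = [set o | X o = t] `&` [set o | Y o = u]).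
  by apply: measurableI; apply: (discrete_rv_measurable (eq^~ _)).
by apply/seteqP; split => o /=; [case=> -> ->|case=> <- <-].
Qed.

Lemma massE (T : Type) (X : Omega -> T) t : discrete_rv X ->
  mu [set o | X o = t] = (mass X t)%:E.
Proof.
move=> dX; rewrite /mass fineK //; apply: fin_num_measure.
exact: (discrete_rv_measurable (eq^~ t)).
Qed.

Lemma mass_ge0 (T : Type) (X : Omega -> T) t : 0 <= mass X t.
Proof. exact/fine_ge0/measure_ge0. Qed.

(** Change of variables for a random variable with finitely many values. *)
Lemma integral_discrete_ge0 T (X : Omega -> T) (Q : pred T) (phi : T -> R) :
  discrete_rv X -> (forall t, 0 <= phi t) ->
  (\int[mu]_(o in [set o | Q (X o)]) (phi (X o))%:E =
    (\sum_(t | Q t) phi t * mass X t)%:E)%E.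
Proof.
move=> dX phi0; set F := fun t => [set o | X o = t].
have mF t : measurable (F t) by exact: (discrete_rv_measurable (eq^~ t)).
have DE : [set o | Q (X o)] = \big[setU/set0]_(t <- [seq t <- enum T | Q t]) F t.
  apply/seteqP; split => o /=; rewrite -bigcup_seq /=.
    by move=> Qo; exists (X o) => //=; rewrite mem_filter Qo mem_enum.
  by move=> [t /=]; rewrite mem_filter => /andP[Qt _] ->.
rewrite DE ge0_integral_bigsetU //=.
- rewrite big_filter big_enum_cond /= -sumEFin; apply: eq_big => // t Qt.
  rewrite (eq_integral (cst (phi t)%:E)); last first.
    by move=> o; rewrite inE /F /= => ->.
  by rewrite integral_cst // EFinM -(massE t dX).
- by rewrite filter_uniq // enum_uniq.
- by move=> t u _ _ [z []]; rewrite /F /= => -> ->.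
- apply: (@discrete_rv_measurable_fun _ X _ (fun t => (phi t)%:E)) => //.
  exact: bigsetU_measurable.
- by move=> o _; rewrite lee_fin.
Qed.

Lemma expectation_discrete T (X : Omega -> T) (phi : T -> R) :
  discrete_rv X -> ('E_mu[phi \o X] = (\sum_t phi t * mass X t)%:E)%E.
Proof.
move=> dX; rewrite unlock integralE.
have H psi : (forall t, 0 <= psi t) ->
    (\int[mu]_o (psi (X o))%:E = (\sum_t psi t * mass X t)%:E)%E.
  move=> psi0; rewrite -(integral_discrete_ge0 predT dX psi0).
  by congr integral; apply/seteqP; split.
rewrite (eq_integral (fun o => (Num.max (phi (X o)) 0)%:E)); last first.
  by move=> o _; rewrite funeposE -EFin_max.
rewrite [X in (_ - X)%E](eq_integral (fun o => (Num.max (- phi (X o)) 0)%:E)); last first.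
  by move=> o _; rewrite funenegE -EFin_max.
rewrite (H (fun t => Num.max (phi t) 0)) => [|t]; last by rewrite le_max lexx orbT.
rewrite (H (fun t => Num.max (- phi t) 0)) => [|t]; last by rewrite le_max lexx orbT.
rewrite -EFinB -sumrB; congr (_%:E); apply: eq_bigr => t _; rewrite -mulrBl; congr (_ * _).
by rewrite /Num.max; case: ifPn; case: ifPn; lra.
Qed.

Lemma sum_mass T (X : Omega -> T) : discrete_rv X -> \sum_t mass X t = 1.
Proof.
move=> dX; have := integral_discrete_ge0 predT dX (fun t => ler01).
rewrite (_ : mkset _ = setT); last by apply/seteqP; split.
rewrite integral_cst // mul1e => /(etrans (esym (probability_setT mu))) [->].
by apply: eq_bigr => t _; rewrite mul1r.
Qed.

End DiscreteVariables.

(** * Histories and independence *)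

(** Records of the first [k] sampling outcomes and coin flips. *)
Fixpoint history {R : realType} {n : nat} (s : sampling R n) (k : nat) :
    finType :=
  if k is k'.+1 then (history s k' * (outcome s * bool))%type else unit.

(** The history observed at the sample point [o]. *)
Fixpoint hist {R : realType} {n : nat} {Omega : Type} {s : sampling R n}
    (S_ : nat -> Omega -> outcome s) (coin : nat -> Omega -> bool)
    (k : nat) (o : Omega) : history s k :=
  if k is k'.+1 then (hist S_ coin k' o, (S_ k' o, coin k' o)) else tt.

(** The randomness independent of the first [k] draws that enters step [k] and the
    Lyapunov function after it. *)
Definition fresh {R : realType} {n : nat} {Omega : Type} {s : sampling R n}
    (S : Omega -> outcome s) (S_ : nat -> Omega -> outcome s)
    (coin : nat -> Omega -> bool) (k : nat) (o : Omega) :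
    outcome s * (bool * outcome s) :=
  (S_ k o, (coin k o, S o)).

(** The indices of the draws that make up the first [k] steps. *)
Fixpoint past (k : nat) : seq (option nat + nat) :=
  if k is k'.+1 then [:: inl (Some k'), inr k' & past k'] else [::].

Lemma past_lt k i : i \in past k ->
  match i with inl None => false | inl (Some j) | inr j => (j < k)%N end.
Proof.
elim: k i => // k IH i; rewrite /= !inE => /or3P[/eqP->|/eqP->|/IH] //.
by case: i => [[j|]|j] // /ltnW.
Qed.

Lemma past_fresh k : uniq [:: inl None, inl (Some k), inr k & past k].
Proof.
have now j : (k <= j)%N -> inl (Some j) \notin past k /\ inr j \notin past k.
  by move=> kj; split; apply/negP => /past_lt; rewrite ltnNge kj.
have never : inl None \notin past k by apply/negP => /past_lt.
rewrite /= !inE !negb_or /= never (now k (leqnn k)).1 (now k (leqnn k)).2 /=.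
elim: k {now never} => //= k ->; rewrite !inE /= andbT.
by apply/andP; split; apply/negP => /past_lt; rewrite ltnn.
Qed.

Section History.
Context {R : realType} {n : nat} {disp : measure_display}
  {Omega : measurableType disp} {mu : probability Omega R}.
Context {s : sampling R n} {p : R} {S : Omega -> outcome s}
  {S_ : nat -> Omega -> outcome s} {coin : nat -> Omega -> bool}.
Context (lr : lsvrg_randomness mu p S S_ coin).
Local Notation hist := (hist S_ coin).
Local Notation history := (history s).
Local Notation fresh := (fresh S S_ coin).

Lemma discrete_rv_hist k : discrete_rv (hist k).
Proof.
elim: k => [|k IH]; first by apply: finite_discrete_rv => -[];
  rewrite (_ : mkset _ = setT) //; apply/seteqP; split.
apply: discrete_rv_pair => //; apply: discrete_rv_pair.
  exact: (lr_Sk_rv lr).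
exact: (lr_coin_rv lr).
Qed.

(** A history is observed exactly when each past draw lies in some prescribed
    event; this is the form in which mutual independence applies. *)
Lemma hist_event k (h : history k) : exists A : option nat + nat -> set Omega,
  (forall i, draws S S_ coin i (A i)) /\
  [set o | hist k o = h] = [set o | forall i, i \in past k -> A i o].
Proof.
elim: k h => [|k IH] h.
  exists (fun=> setT); split.
    by move=> [[j|]|j]; exists setT => //; rewrite preimage_setT.
  by apply/seteqP; split => o //= _; case: h.
case: h => h [C b]; have [A [dA hA]] := IH h.
exists (fun i => if i == inl (Some k) then [set o | S_ k o = C]
  else if i == inr k then [set o | coin k o = b] else A i); split.
  move=> i; case: eqVneq => [->|_]; first by exists [set C].
  by case: eqVneq => [->|_] //; exists [set b].
have := past_fresh k => /= /and4P[_ nS nc _].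
have hE o : hist k o = h <-> forall i, i \in past k -> A i o.
  by rewrite -[X in _ <-> X]/([set o | forall i, i \in past k -> A i o] o) -hA.
apply/seteqP; split => o /=.
  case=> /hE Ao So co i; rewrite !inE => /or3P[/eqP->|/eqP->|ip].
  - by rewrite eqxx.
  - by rewrite /= eqxx.
  - case: eqP => [iE|_]; first by rewrite -iE inE ip orbT in nS.
    by case: eqP => [iE|_]; [rewrite -iE ip in nc|exact: Ao].
move=> H; have := H (inl (Some k)); rewrite !inE eqxx => /(_ isT) ->.
have := H (inr k); rewrite !inE eqxx orbT /= => /(_ isT) ->.
congr (_, _); apply/hE => i ip; have := H i; rewrite !inE ip !orbT => /(_ isT).
case: eqP => [iE|_]; first by rewrite -iE inE ip orbT in nS.
by case: eqP => [iE|//]; rewrite -iE ip in nc.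
Qed.

Lemma discrete_rv_hist_fresh k : discrete_rv (fun o => (hist k o, fresh k o)).
Proof.
apply: discrete_rv_pair; first exact: discrete_rv_hist.
apply: discrete_rv_pair; first exact: (lr_Sk_rv lr).
by apply: discrete_rv_pair; [exact: (lr_coin_rv lr)|exact: (lr_S_rv lr)].
Qed.

Lemma mass_coin k b : mass mu (coin k) b = if b then p else 1 - p.
Proof.
have pT : mass mu (coin k) true = p by rewrite /mass (lr_coin_law lr k).
have := sum_mass mu (lr_coin_rv lr (k := k)); rewrite big_bool /= pT.
by case: b => // <-; rewrite addrAC subrr add0r.
Qed.

Lemma mass_sample k C : mass mu (S_ k) C = mass mu S C.
Proof. by rewrite /mass (lr_Sk_law lr k). Qed.

(** The joint law of the history and the fresh draws is a product. *)
Lemma mass_hist_fresh k (h : history k) C b C' :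
  mass mu (fun o => (hist k o, fresh k o)) (h, (C, (b, C'))) =
  mass mu (hist k) h *
    (mass mu S C * ((if b then p else 1 - p) * mass mu S C')).
Proof.
have [A [dA hA]] := hist_event h.
have /= /and4P[nN nS nc up] := past_fresh k.
pose B i := if i == inl None then [set o | S o = C']
  else if i == inl (Some k) then [set o | S_ k o = C]
  else if i == inr k then [set o | coin k o = b] else A i.
have dB i : draws S S_ coin i (B i).
  rewrite /B; case: eqVneq => [->|_]; first by exists [set C'].
  case: eqVneq => [->|_]; first by exists [set C].
  by case: eqVneq => [->|_] //; exists [set b].
have BA i : i \in past k -> B i = A i.
  move=> ip; rewrite /B; case: eqP => [iE|_]; first by rewrite -iE !inE ip !orbT in nN.
  case: eqP => [iE|_]; first by rewrite -iE !inE ip !orbT in nS.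
  by case: eqP => [iE|//]; rewrite -iE ip in nc.
have muh : mu [set o | hist k o = h] = (\prod_(i <- past k) mu (A i))%E.
  by rewrite hA; apply: (lr_indep lr) => // i _; exact: dA.
have := lr_indep lr (past_fresh k) (fun i _ => dB i).
have BS : B (inl (Some k)) = [set o | S_ k o = C] by rewrite /B eqxx.
have Bc : B (inr k) = [set o | coin k o = b] by rewrite /B /= eqxx.
rewrite !big_cons BS Bc -[B (inl None)]/[set o | S o = C'].
rewrite (eq_big_seq (fun i => mu (A i))) => [|i ip]; last by rewrite BA.
rewrite -muh (massE mu C' (lr_S_rv lr)) (massE mu C (lr_Sk_rv lr (k := k))).
rewrite (massE mu b (lr_coin_rv lr (k := k))) (massE mu h (discrete_rv_hist (k := k))).
rewrite -!EFinM mass_coin mass_sample => E.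
rewrite {1}/mass (_ : mkset _ = [set o | forall i,
    i \in [:: inl None, inl (Some k), inr k & past k] -> B i o]).
  by rewrite E /=; ring.
have hE o : hist k o = h <-> forall i, i \in past k -> A i o.
  by rewrite -[X in _ <-> X]/([set o | forall i, i \in past k -> A i o] o) -hA.
apply/seteqP; split => o /=.
  rewrite /fresh => -[/hE Ao So co S'o] i; rewrite in_cons => /orP[/eqP->//|].
  rewrite in_cons => /orP[/eqP->|]; first by rewrite /B eqxx.
  rewrite in_cons => /orP[/eqP->|ip]; first by rewrite /B /= eqxx.
  by rewrite BA //; exact: Ao.
move=> H; rewrite /fresh.
have := H (inl None); rewrite inE eqxx => /(_ isT) ->.
have := H (inl (Some k)); rewrite !inE eqxx orbT /B /= eqxx => /(_ isT) ->.
have := H (inr k); rewrite !inE eqxx !orbT /B /= eqxx => /(_ isT) ->.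
congr (_, _); apply/hE => i ip; rewrite -BA //; apply: H.
by rewrite !inE ip !orbT.
Qed.

End History.

(** * Convergence of L-SVRG *)

(** The inequality 2/5 (a_0 + ... + a_k) + 3/5 a_k + b_k <= a_0 + b_0 is preserved
    from k to k + 1. *)
Lemma telescoped_sum_le (R : realFieldType) (a b : nat -> R) :
  (forall k, 0 <= a k) -> (forall k, 0 <= b k) ->
  (forall k, a k.+1 + b k.+1 <= 3 / 5 * a k + b k) ->
  forall k, \sum_(i < k.+1) a i <= 5 / 2 * (a 0%N + b 0%N).
Proof.
move=> a0 b0 H k.
have : 2 / 5 * \sum_(i < k.+1) a i + 3 / 5 * a k + b k <= a 0%N + b 0%N.
  elim: k => [|k IH]; first by rewrite big_ord1; lra.
  rewrite big_ord_recr /=; have := H k; move: IH.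
  by move: (\sum_(i < k.+1) a i) => A; lra.
have := a0 k; have := b0 k; lra.
Qed.

(** Jensen's inequality for uniform averages, for a predicate [Q x a] that describes
    the convex epigraph of a function. *)
Lemma epigraph_mean (R : realFieldType) (V : lmodType R) (Q : V -> R -> Prop)
    (y : nat -> V) (b : nat -> R) :
  (forall x z a c t, 0 <= t <= 1 -> Q x a -> Q z c ->
    Q (t *: x + (1 - t) *: z) (t * a + (1 - t) * c)) ->
  (forall i, Q (y i) (b i)) ->
  forall k, Q (k.+1%:R^-1 *: \sum_(i < k.+1) y i)
              (k.+1%:R^-1 * \sum_(i < k.+1) b i).
Proof.
move=> cQ Qy; elim=> [|k IH]; first by rewrite !big_ord1 invr1 scale1r mul1r.
set t : R := k.+2%:R^-1.
have t01 : 0 <= t <= 1 by rewrite invr_ge0 ler0n invf_le1 ?ltr0n // ler1n.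
have tk : (1 - t) / k.+1%:R = t.
  have k1 : 0 < k.+1%:R :> R by rewrite ltr0n.
  rewrite /t -[k.+2%:R]natr1; move: k.+1%:R k1 => m m0.
  by field; rewrite !gt_eqF //; lra.
have := cQ _ _ _ _ t t01 (Qy k.+1) IH.
rewrite scalerA mulrA tk -scalerDr -mulrDr [y _ + _]addrC [b _ + _]addrC.
by rewrite [in X in _ -> X]big_ord_recr [\sum_(i < k.+2) b i]big_ord_recr.
Qed.

Section Lsvrg.
Context {R : realType} {n d : nat} {disp : measure_display}
  {Omega : measurableType disp} {mu : probability Omega R}.
Context {f_ : 'I_n -> 'cV[R]_d -> R} {psi : 'cV[R]_d -> \bar R}
  {s : sampling R n} {S : Omega -> outcome s}
  {S_ : nat -> Omega -> outcome s} {coin : nat -> Omega -> bool}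
  {eta p Lf L1 : R} {x0 xs : 'cV[R]_d}.
Context (lr : lsvrg_randomness mu p S S_ coin).
Local Notation f := (average f_).
Local Notation xw := (lsvrg f_ psi eta x0 S_ coin).
Local Notation x := (lsvrg_x f_ psi eta x0 S_ coin).
Local Notation w := (lsvrg_w f_ psi eta x0 S_ coin).
Local Notation Psi := (lsvrg_Psi f_ psi eta x0 S_ coin S xs p).
Local Notation gap := (gap f_ psi xs).
Local Notation next_x := (@next_x R n d f_ psi eta s).
Local Notation q := (mass mu S).
Local Notation meanH := (meanH f_ q xs).
Local Notation hist := (hist S_ coin).
Local Notation history := (history s).

(** The pair of iterates computed from a history. *)
Fixpoint run (k : nat) : history k -> 'cV[R]_d * 'cV[R]_d :=
  if k is k'.+1 then fun h => lsvrg_step f_ psi eta h.2.1 h.2.2 (run h.1)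
  else fun=> (x0, x0).

Lemma lsvrg_run k o : xw k o = run (hist k o).
Proof. by elim: k => //= k ->. Qed.

Lemma lsvrg_xS k o : x k.+1 o = next_x (S_ k o) (xw k o).
Proof. by rewrite /lsvrg_x /next_x /=; case: (xw k o). Qed.

Lemma lsvrg_wS k o : w k.+1 o = if coin k o then x k o else w k o.
Proof. by rewrite /lsvrg_w /lsvrg_x /=; case: (xw k o). Qed.

(** The integral of a function of the history and of the fresh draws over an event
    determined by the history, as an iterated sum. *)
Lemma integral_hist_fresh k (X : pred (history k))
    (phi : history k -> outcome s -> bool -> outcome s -> R) :
  (forall h C b C', 0 <= phi h C b C') ->
  (\int[mu]_(o in [set o | X (hist k o)])
     (phi (hist k o) (S_ k o) (coin k o) (S o))%:E =
   (\sum_(h | X h) mass mu (hist k) h *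
      \sum_C q C * \sum_C' q C' * (p * phi h C true C' + (1 - p) * phi h C false C'))%:E)%E.
Proof.
move=> phi0.
have := integral_discrete_ge0 mu (fun t => X t.1) (discrete_rv_hist_fresh lr (k := k))
  (phi := fun t => phi t.1 t.2.1 t.2.2.1 t.2.2.2) (fun t => phi0 _ _ _ _).
move=> -> ; congr (_%:E).
pose m h u := mass mu (fun o => (hist k o, fresh S S_ coin k o)) (h, u).
transitivity (\sum_(h | X h) \sum_u phi h u.1 u.2.1 u.2.2 * m h u).
  by rewrite pair_big_dep /=; apply: eq_big => [[h u]|[h u] _] //=; rewrite andbT.
apply: eq_bigr => h _; rewrite mulr_sumr.
transitivity (\sum_C \sum_v phi h C v.1 v.2 * m h (C, v)).
  by rewrite pair_big_dep /=; apply: eq_big => [[]|[]] //.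
apply: eq_bigr => C _; rewrite mulrA mulr_sumr.
transitivity (\sum_b \sum_C' phi h C b C' * m h (C, (b, C'))).
  by rewrite pair_big_dep /=; apply: eq_big => [[]|[]] //.
rewrite big_bool /= -big_split /=; apply: eq_bigr => C' _.
by rewrite /m !(mass_hist_fresh lr); ring.
Qed.

Context (df_ : forall i y, differentiable (f_ i) y).
Context (pcc : proper_closed_convex psi).
Context (ms : minimizer (objective f_ psi) xs).
Context (eta0 : 0 < eta) (p01 : 0 < p <= 1).
Context (cf : convex_on_space f).
Context (Lf0 : 0 < Lf) (cg : convex_on_space (fun y => Lf / 2 * sqnorm y - f y)).
Context (unb : (\sum_C q C *: (thetamx C *m Imx C)) *m ones = ones :> 'cV[R]_n).
Context (L10 : 0 < L1).
Context (expected_smooth : forall y,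
  meanH y <= 2 * L1 * (f y - f xs - dot (grad f xs) (y - xs))).

Lemma psi_xS_fin k o : psi (x k.+1 o) \is a fin_num.
Proof. by rewrite lsvrg_xS; exact: (next_x_fin df_ pcc ms eta0). Qed.

Lemma sum_sample : \sum_C q C = 1.
Proof. exact: (sum_mass mu (lr_S_rv lr)). Qed.

Let alpha := 6 * eta / (5 * p).

Let alpha_ge0 : 0 <= alpha.
Proof. by case/andP: p01 => p0 _; rewrite divr_ge0 ?mulr_ge0 // ltW. Qed.

Let c_ge0 : 0 <= (2 * eta)^-1.
Proof. by rewrite invr_ge0 mulr_ge0 // ltW. Qed.

Let H (y : 'cV[R]_d) (C : outcome s) :=
  sqnorm (sampled C (gradmx f_ y - gradmx f_ xs)).

Let mean_coin (c a : R) (y z : 'cV[R]_d) :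
  \sum_C q C * (p * (c + a * H y C) + (1 - p) * (c + a * H z C)) =
  c + a * (p * meanH y + (1 - p) * meanH z).
Proof.
transitivity (\sum_C (q C * c + a * (p * (q C * H y C) + (1 - p) * (q C * H z C)))).
  by apply: eq_bigr => C _; move: (H y C) (H z C) => u v; ring.
rewrite big_split /= -mulr_suml sum_sample mul1r -mulr_sumr big_split /=.
by congr (_ + _ * (_ + _)); rewrite /meanH [RHS]mulr_sumr.
Qed.

Lemma Psi_ge0 k o : 0 <= Psi k o.
Proof. by rewrite /lsvrg_Psi addr_ge0 // mulr_ge0 // sqnorm_ge0. Qed.

(** The one-step decrease integrated over an event determined by the history.  The
    optimality gap is assumed finite on the event, so that all terms are real numbers. *)
Lemma past_decrease k (X : pred (history k)) (A := [set o | X (hist k o)]) :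
  eta <= Num.min (1 / (8 * L1)) (1 / (6 * Lf)) ->
  (forall h, X h -> psi (run h).1 \is a fin_num) ->
  exists a' b' a b,
  [/\ (\int[mu]_(o in A) gap (x k.+1 o) = a'%:E)%E,
      (\int[mu]_(o in A) (Psi k.+1 o)%:E = b'%:E)%E,
      (\int[mu]_(o in A) gap (x k o) = a%:E)%E,
      (\int[mu]_(o in A) (Psi k o)%:E = b%:E)%E &
      a' + b' <= 3 / 5 * a + b].
Proof.
move=> eta_le fin.
have p0 : 0 <= p by case/andP: p01 => /ltW.
have p1 : 0 <= 1 - p by case/andP: p01 => _; rewrite subr_ge0.
(* the four integrands as functions of the history and of the fresh draws *)
pose phi1 h C (b : bool) (C' : outcome s) := fine (gap (next_x C (@run k h))).
pose phi2 h C b C' := (2 * eta)^-1 * sqnorm (next_x C (@run k h) - xs)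
  + alpha * H (if b then (run h).1 else (run h).2) C'.
pose phi3 h (C : outcome s) (b : bool) (C' : outcome s) := fine (gap (@run k h).1).
pose phi4 h (C : outcome s) (b : bool) C' := (2 * eta)^-1 * sqnorm ((@run k h).1 - xs)
  + alpha * H (run h).2 C'.
have H0 y C : 0 <= H y C by exact: sqnorm_ge0.
have g0 y : 0 <= fine (gap y) by exact: (fine_gap_ge0 pcc ms).
do 4 eexists; split.
- rewrite (eq_integral (fun o => (phi1 (hist k o) (S_ k o) (coin k o) (S o))%:E)).
    by apply: (@integral_hist_fresh k X phi1) => *; exact: g0.
  move=> o _; rewrite /phi1 -lsvrg_run -lsvrg_xS fineK //.
  exact/(gap_fin pcc ms)/psi_xS_fin.
- rewrite (eq_integral (fun o => (phi2 (hist k o) (S_ k o) (coin k o) (S o))%:E)).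
    apply: (@integral_hist_fresh k X phi2) => *.
    by rewrite addr_ge0 // mulr_ge0 // sqnorm_ge0.
  move=> o _; rewrite /phi2 -lsvrg_run -lsvrg_xS /lsvrg_Psi /lsvrg_H lsvrg_wS.
  by [].
- rewrite (eq_integral (fun o => (phi3 (hist k o) (S_ k o) (coin k o) (S o))%:E)).
    by apply: (@integral_hist_fresh k X phi3) => *; exact: g0.
  move=> o; rewrite inE /A /= => Xo; rewrite /phi3 -lsvrg_run fineK //.
  by apply: (gap_fin pcc ms); rewrite lsvrg_run; exact: fin.
- rewrite (eq_integral (fun o => (phi4 (hist k o) (S_ k o) (coin k o) (S o))%:E)).
    apply: (@integral_hist_fresh k X phi4) => *.
    by rewrite addr_ge0 // mulr_ge0 // sqnorm_ge0.
  by move=> o _; rewrite /phi4 -lsvrg_run.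
(* the inequality holds for each history separately *)
rewrite mulr_sumr -!big_split /=; apply: ler_sum => h Xh.
rewrite mulrCA -!mulrDr; apply: ler_wpM2l; first exact: mass_ge0.
rewrite /phi1 /phi2 /phi3 /phi4.
have const c : \sum_C' q C' * (p * c + (1 - p) * c) = c.
  by rewrite -mulr_suml sum_sample; ring.
under eq_bigr do rewrite const.
under [X in _ + X]eq_bigr do rewrite /= mean_coin mulrDr.
rewrite big_split /= -mulr_suml sum_sample mul1r.
under [X in 3 / 5 * X]eq_bigr do rewrite const.
rewrite -(mulr_suml _ _ _ (fine _)) sum_sample mul1r.
under [X in _ <= _ + X]eq_bigr do rewrite mean_coin.
rewrite -[X in _ <= _ + X]mulr_suml sum_sample mul1r.
have {fin} := fin h Xh; case: (run h) => y z /= yfin.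
have := lsvrg_step_decrease df_ pcc ms eta0 p01 cf Lf0 cg
  (fun C => mass_ge0 mu S C) sum_sample unb L10 expected_smooth z eta_le yfin.
rewrite -/alpha => step; apply: (le_trans step).
by rewrite le_eqVlt; apply/orP; left; apply/eqP; move: (meanH z) => m; ring.
Qed.

(** Conditioning on the state amounts to averaging over the event that the state
    has its current value.  When this event is null, both conditional expectations are 0
    and the inequality holds because gaps are nonnegative; when the current gap is
    infinite, the left-hand side is -oo. *)
Lemma conditional_decrease k o :
  eta <= Num.min (1 / (8 * L1)) (1 / (6 * Lf)) ->
  (cond_expectation mu (xw k) (fun o' => gap (x k.+1 o')) o
     - (3 / 5)%:E * gap (x k o)
   <= cond_expectation mu (xw k) (fun o' => (Psi k o')%:E) o
      - cond_expectation mu (xw k) (fun o' => (Psi k.+1 o')%:E) o)%E.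
Proof.
move=> eta_le.
have [nNy _ _ _] := pcc; have [as_ xsa] := psi_xs_fin pcc ms.
case: (boolP (psi (x k o) \is a fin_num)) => [xfin|]; last first.
  rewrite fin_numE nNy /= negbK => /eqP xoo.
  have -> : gap (x k o) = +oo%E by rewrite /gap /objective xoo xsa.
  by rewrite mulry gtr0_sg // mul1e addeNy leNye.
pose X h := @run k h == xw k o.
have AE : [set v | xw k v = xw k o] = [set v | X (hist k v)].
  by apply/seteqP; split => v /=; rewrite /X -lsvrg_run => /eqP.
have [h Xh|a' [b' [a [b [E1 E2 E3 E4 le_ab]]]]] := @past_decrease k X eta_le.
  by rewrite (eqP Xh).
pose mA := fine (mu [set v | X (hist k v)]).
have C1 Y y : (\int[mu]_(v in [set v | X (hist k v)]) Y v = y%:E)%E ->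
    cond_expectation mu (xw k) Y o = (mA^-1 * y)%:E.
  by rewrite -AE => EY; rewrite /cond_expectation EY /mA -AE -EFinM.
have mA0 : 0 <= mA by exact/fine_ge0/measure_ge0.
have mX : measurable [set v | X (hist k v)].
  exact: (discrete_rv_measurable X (discrete_rv_hist lr (k := k))).
have gfin : gap (x k o) \is a fin_num by exact: (gap_fin pcc ms).
have aE : a = fine (gap (x k o)) * mA.
  apply: EFin_inj; rewrite -E3 EFinM fineK // fineK; last exact: fin_num_measure.
  rewrite (eq_integral (cst (gap (x k o)))) ?integral_cst // => v.
  by rewrite inE /= /X -lsvrg_run => /eqP; rewrite /lsvrg_x => ->.
have sub_le u v z (u' v' z' t : R) : u = u'%:E -> v = v'%:E -> z = z'%:E ->
    u' - t <= v' - z' -> (u - t%:E <= v - z)%E.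
  by move=> -> -> ->; rewrite -!EFinB lee_fin.
rewrite -(fineK gfin) -EFinM.
apply: (sub_le _ _ _ _ _ _ _ (C1 _ _ E1) (C1 _ _ E4) (C1 _ _ E2)).
move: le_ab; rewrite aE; set g := fine _.
have g0 : 0 <= g by exact: (fine_gap_ge0 pcc ms).
move: mA mA0 {aE C1} => m m0 le_ab.
have [->|mN0] := eqVneq m 0; first by rewrite invr0 !mul0r; lra.
have mp : 0 < m by rewrite lt_neqAle eq_sym mN0.
rewrite -(ler_pM2l mp) !mulrBr !mulrA mulfV // !mul1r; lra.
Qed.

Lemma meanH_expectation y :
  'E_mu[fun o => sqnorm (sampled (S o) (gradmx f_ y - gradmx f_ xs))]%E
  = (meanH y)%:E.
Proof.
rewrite (expectation_discrete mu (H y) (lr_S_rv lr)).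
by congr (_%:E); apply: eq_bigr => C _; rewrite mulrC.
Qed.

Lemma gap_convex (y z : 'cV[R]_d) (a b t : R) : 0 <= t <= 1 ->
  (gap y <= a%:E)%E -> (gap z <= b%:E)%E ->
  (gap (t *: y + (1 - t) *: z)%R <= (t * a + (1 - t) * b)%:E)%E.
Proof.
have [c xsc] := psi_xs_fin pcc ms.
have gapP v e : (gap v <= e%:E)%E <-> (psi v <= (e + (f xs + c) - f v)%:E)%E.
  rewrite /gap /objective xsc.
  have [nNy _ _ _] := pcc; have := nNy v; case: (psi v) => [r| |] // _.
  by rewrite -!EFinD !lee_fin; split => h; lra.
move=> t01 /gapP ya /gapP zb; apply/gapP.
apply: le_trans (psi_convex_le pcc t01 ya zb) _; rewrite lee_fin.
have := convex_on_spaceP cf y z t01; lra.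
Qed.

Lemma sum_x_hist k : exists g : history k -> 'cV[R]_d,
  forall o, \sum_(i < k.+1) x i o = g (hist k o).
Proof.
elim: k => [|k [g gE]].
  by exists (fun=> x0) => o; rewrite big_ord1.
exists (fun h : history k.+1 => g h.1 + (@run k.+1 h).1) => o.
by rewrite big_ord_recr /= gE /lsvrg_x lsvrg_run.
Qed.

(** The initial value of the Lyapunov function, bounded by expected smoothness. *)
Lemma integral_Psi0_le : psi x0 \is a fin_num ->
  exists2 b, (\int[mu]_o (Psi 0 o)%:E = b%:E)%E &
   b <= (2 * eta)^-1 * sqnorm (x0 - xs) + alpha * (2 * L1 * fine (gap x0)).
Proof.
move=> x0fin; exists ((2 * eta)^-1 * sqnorm (x0 - xs) + alpha * meanH x0).
  have := expectation_discrete mu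
    (fun C => (2 * eta)^-1 * sqnorm (x0 - xs) + alpha * H x0 C) (lr_S_rv lr).
  rewrite unlock => ->; congr (_%:E).
  transitivity (\sum_C (q C * ((2 * eta)^-1 * sqnorm (x0 - xs)) + alpha * (q C * H x0 C))).
    by apply: eq_bigr => C _; move: (H x0 C) (sqnorm _) => u v; ring.
  by rewrite big_split /= -mulr_suml sum_sample mul1r -mulr_sumr.
rewrite lerD2l; apply: ler_wpM2l => //.
exact: (meanH_le_gap df_ pcc ms L10 expected_smooth x0fin).
Qed.

(** The ergodic rate when the initial gap is finite. *)
Lemma integral_gap_mean_le k : psi x0 \is a fin_num ->
  Lf <= L1 -> eta = 1 / (8 * L1) ->
  (\int[mu]_o gap (lsvrg_mean f_ psi eta x0 S_ coin k o) <=
   (k.+1%:R^-1 * (10 * L1 * sqnorm (x0 - xs)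
      + (5 / 2 + 3 / (4 * p)) * fine (gap x0)))%:E)%E.
Proof.
move=> x0fin LfL1 etaE; have LL : 6 * Lf <= 8 * L1.
  by apply: ler_pM => //; [exact: ltW|rewrite ler_nat].
have eta_le : eta <= Num.min (1 / (8 * L1)) (1 / (6 * Lf)).
  rewrite etaE le_min lexx /= !mul1r lef_pV2 ?posrE ?mulr_gt0 //.
have xfin i o : psi (x i o) \is a fin_num by case: i => // i; exact: psi_xS_fin.
have gfin i o : gap (x i o) \is a fin_num by exact: (gap_fin pcc ms).
have g0 y : (0 <= gap y)%E by exact: (gap_ge0 pcc ms).
have runfin i (h : history i) : psi (run h).1 \is a fin_num.
  case: i h => //= i h; case: (run h.1) => y z.
  exact: (next_x_fin df_ pcc ms eta0 h.2.1 (y, z)).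
pose a i := fine (\int[mu]_o gap (x i o))%E.
pose b i := fine (\int[mu]_o (Psi i o)%:E)%E.
have step i : [/\ (\int[mu]_o gap (x i o) = (a i)%:E)%E &
    a i.+1 + b i.+1 <= 3 / 5 * a i + b i].
  have [h _|a' [b' [a1 [b1]]]] := @past_decrease i predT eta_le; first exact: runfin.
  rewrite (_ : [set o | _] = setT); last by apply/seteqP; split.
  move=> [E1 E2 E3 E4 le_ab].
  have ai : a i = a1 := congr1 fine E3.
  have ai' : a i.+1 = a' := congr1 fine E1.
  have bi : b i = b1 := congr1 fine E4.
  have bi' : b i.+1 = b' := congr1 fine E2.
  by rewrite ai ai' bi bi'.
have a0 i : 0 <= a i by apply: fine_ge0; apply: integral_ge0.
have b0 i : 0 <= b i.
  by apply: fine_ge0; apply: integral_ge0 => o _; rewrite lee_fin Psi_ge0.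
have sum_le := telescoped_sum_le a0 b0 (fun i => (step i).2) k.
have [b1 Eb b1_le] := integral_Psi0_le x0fin.
have a00 : a 0%N = fine (gap x0).
  apply: (congr1 fine (etrans (integral_cst mu measurableT (gap x0)) _)).
  exact: etrans (congr1 (mule (gap x0)) (probability_setT mu)) (mule1 _).
have b00 : b 0%N = b1 := congr1 fine Eb.
have mgap i : measurable_fun setT (fun o => gap (x i o)).
  apply: (discrete_rv_measurable_fun gap) => //.
  rewrite (_ : x i = (fst \o @run i) \o hist i).
    by apply: discrete_rv_comp; exact: (discrete_rv_hist lr).
  by apply/funext => o; rewrite /lsvrg_x lsvrg_run.
have [g gE] := sum_x_hist k.
have k0 : 0 <= k.+1%:R^-1 :> R by rewrite invr_ge0.
apply: (@le_trans _ _ (\int[mu]_o (k.+1%:R^-1%:E * \sum_(i < k.+1) gap (x i o)))%E).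
  apply: ge0_le_integral => //.
  - have -> : (fun o => gap (lsvrg_mean f_ psi eta x0 S_ coin k o)) =
        (fun h => gap (k.+1%:R^-1 *: g h)) \o hist k.
      by apply/funext => o; rewrite /lsvrg_mean gE.
    by apply: discrete_rv_measurable_fun => //; exact: (discrete_rv_hist lr).
  - by apply: measurable_funeM; exact: emeasurable_sum.
  - move=> o _.
    have Q i : (gap (x i o) <= (fine (gap (x i o)))%:E)%E by rewrite fineK.
    have := epigraph_mean (Q := fun v e => (gap v <= e%:E)%E)
      (fun y z a c t t01 => @gap_convex y z a c t t01) Q k.
    rewrite EFinM -sumEFin; under [X in (_ <= _ * X)%E -> _]eq_bigr do rewrite fineK //.
    by [].
rewrite ge0_integralZl_EFin //; first last.
- exact: emeasurable_sum.
- by move=> o _; apply: sume_ge0.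
rewrite ge0_integral_sum // (eq_bigr (fun i : 'I_k.+1 => (a i)%:E)); last first.
  by move=> i _; exact: (step i).1.
rewrite sumEFin -EFinM lee_fin; apply: ler_wpM2l => //.
apply: (le_trans sum_le); rewrite a00 b00.
have p0 : 0 < p by case/andP: p01.
have h1 : (2 * eta)^-1 = 4 * L1 by rewrite etaE; field; rewrite gt_eqF.
have h2 : alpha * (2 * L1 * fine (gap x0)) = 3 / 10 / p * fine (gap x0).
  by rewrite /alpha etaE; field; rewrite !gt_eqF.
move: b1_le; rewrite h1 h2.
rewrite [3 / (4 * p)](_ : _ = 3 / 4 / p); last by rewrite invfM mulrA.
lra.
Qed.

End Lsvrg.

Lemma sampling_unbiased (R : realType) (n : nat) (disp : measure_display)
    (Omega : measurableType disp) (mu : probability Omega R) (p : R)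
    (s : sampling R n) (S : Omega -> outcome s)
    (S_ : nat -> Omega -> outcome s) (coin : nat -> Omega -> bool) :
  lsvrg_randomness mu p S S_ coin ->
  (\sum_C mass mu S C *: (thetamx C *m Imx C)) *m ones = ones :> 'cV[R]_n.
Proof.
move=> lr; rewrite -[RHS](lr_S_unbiased lr); congr (_ *m _).
apply/matrixP => i j; rewrite mxE summxE.
have -> := expectation_discrete mu (fun C => (thetamx C *m Imx C) i j) (lr_S_rv lr).
by apply: eq_bigr => C _; rewrite mxE mulrC.
Qed.

(* The constant C hidden in O(.) is chosen before all problem data, so that it
   depends only on |x0 - xstar|^2 and P(x0) - P(xstar). *)
Theorem theorem4p1 (R : realType) :
  exists C : R -> R -> R,
  forall (n d : nat) (disp : measure_display) (Omega : measurableType disp)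
    (mu : probability Omega R)
    (f_ : 'I_n -> 'cV[R]_d -> R) (psi : 'cV[R]_d -> \bar R)
    (s : sampling R n) (S : Omega -> outcome s)
    (S_ : nat -> Omega -> outcome s) (coin : nat -> Omega -> bool)
    (eta p Lf L1 : R) (x0 xstar : 'cV[R]_d),
  let f := average f_ in
  let P := objective f_ psi in
  let x := lsvrg_x f_ psi eta x0 S_ coin in
  let xtilde := lsvrg_mean f_ psi eta x0 S_ coin in
  let Psi := lsvrg_Psi f_ psi eta x0 S_ coin S xstar p in
  let E_ k := cond_expectation mu (lsvrg f_ psi eta x0 S_ coin k) in
  (0 < n)%N ->
  (forall i y, differentiable (f_ i) y) ->
  proper_closed_convex psi ->
  0 < eta -> 0 < p <= 1 ->
  lsvrg_randomness mu p S S_ coin ->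
  convex_on_space f ->
  0 < Lf -> convex_on_space (fun y => Lf / 2 * sqnorm y - f y) ->
  minimizer P xstar ->
  0 < L1 ->
  (forall y, ('E_mu[fun o => sqnorm (sampled (S o) (gradmx f_ y - gradmx f_ xstar))]
     <= (2 * L1 * (f y - f xstar - dot (grad f xstar) (y - xstar)))%:E)%E) ->
  [/\ eta <= Num.min (1 / (8 * L1)) (1 / (6 * Lf)) ->
      forall k : nat, {ae mu, forall o,
        (E_ k (fun o' => P (x k.+1 o') - P xstar) o
           - (3 / 5)%:E * (P (x k o) - P xstar)
         <= E_ k (fun o' => (Psi k o')%:E) o
            - E_ k (fun o' => (Psi k.+1 o')%:E) o)%E},
      Lf <= L1 -> eta = 1 / (8 * L1) ->
      forall k : nat,
        (\int[mu]_o (P (xtilde k o) - P xstar)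
         <= (k.+1%:R^-1)%:E *
            ((10 * L1 * sqnorm (x0 - xstar))%:E
             + (5 / 2 + 3 / (4 * p))%:E * (P x0 - P xstar)))%E &
      Lf <= L1 -> eta = 1 / (8 * L1) -> P x0 != +oo%E ->
      forall (eps : R) (k : nat), 0 < eps ->
        C (sqnorm (x0 - xstar)) (fine (P x0 - P xstar)%E)
          * ((L1 + 1 / p) * (1 / eps)) <= k%:R ->
        (\int[mu]_o (P (xtilde k o) - P xstar) <= eps%:E)%E].
Proof.
exists (fun a b => 10 * a + 13 / 4 * b).
move=> n d disp Omega mu f_ psi s S S_ coin eta p Lf L1 x0 xs f P x xtilde Psi E_.
move=> n0 df pcc eta0 p01 lr cf Lf0 cg ms L10 smooth.
have unb := sampling_unbiased lr.
have Hs y : meanH f_ (mass mu S) xs y <=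
    2 * L1 * (f y - f xs - dot (grad f xs) (y - xs)).
  by have := smooth y; rewrite (meanH_expectation lr) lee_fin.
have [nNy _ _ _] := pcc; have [a xsa] := psi_xs_fin pcc ms.
have p0 : 0 < p by case/andP: p01.
have Px0 : P x0 != +oo%E -> psi x0 \is a fin_num.
  by rewrite fin_numE nNy /= /P /objective; case: (psi x0).
have mean_le k (x0fin : psi x0 \is a fin_num) :=
  @integral_gap_mean_le _ _ _ _ _ mu f_ psi s S S_ coin eta p Lf L1 x0 xs
   lr df pcc ms eta0 p01 cf Lf0 cg unb L10 Hs k x0fin.
have gapx0 (x0fin : psi x0 \is a fin_num) :
  (P x0 - P xs)%E = (fine (gap f_ psi xs x0))%:E.
  by rewrite fineK //; exact: (gap_fin pcc ms).
split.
- move=> eta_le k; apply: aeW => o.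
  exact: (conditional_decrease lr df pcc ms eta0 p01 cf Lf0 cg unb L10 Hs k o eta_le).
- move=> LfL1 etaE k; have [x0oo|/Px0 x0fin] := eqVneq (P x0) +oo%E.
    have c0 : 0 < 5 / 2 + 3 / (4 * p) by rewrite addr_gt0 ?divr_gt0 ?mulr_gt0.
    rewrite x0oo (_ : (+oo - P xs)%E = +oo%E); last by rewrite /P /objective xsa.
    rewrite mulry gtr0_sg // mul1e addey //.
    by rewrite mulry gtr0_sg ?invr_gt0 // mul1e leey.
  by apply: (le_trans (mean_le k x0fin LfL1 etaE)); rewrite (gapx0 x0fin) EFinM EFinD EFinM.
- move=> LfL1 etaE /Px0 x0fin eps k eps0; rewrite (gapx0 x0fin) /= => hk.
  apply: (le_trans (mean_le k x0fin LfL1 etaE)); rewrite lee_fin.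
  have g0 : 0 <= fine (gap f_ psi xs x0) by exact: (fine_gap_ge0 pcc ms).
  have q0 := sqnorm_ge0 (x0 - xs).
  move: hk g0 q0; move: (sqnorm _) (fine _) => A G hk G0 A0.
  rewrite ler_pdivrMl ?ltr0n //.
  have k1 : (10 * A + 13 / 4 * G) * (L1 + 1 / p) <= k%:R * eps.
    by move: hk; rewrite (div1r eps) mulrA ler_pdivrMr.
  have pV : 1 <= p^-1 by rewrite invf_ge1 //; case/andP: p01.
  rewrite -natr1 mulrDl mul1r.
  rewrite [3 / (4 * p)](_ : _ = 3 / 4 * p^-1); last by rewrite invfM mulrA.
  rewrite div1r in k1; move: p^-1 pV k1 => r r1 k1.
  apply: (@le_trans _ _ ((10 * A + 13 / 4 * G) * (L1 + r))); last lra.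
  nra.
Qed.
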